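(* Let $d\ge1$ and let $H$ be a hypergraph of $d$-intervals. Then $\tau^*(H)\le\left(4d-6+\frac{3}{d}\right)\nu(H)$.
   Context: A $d$-interval is a union of at most $d$ pairwise disjoint closed intervals of the real line $\mathbb{R}$. A hypergraph of $d$-intervals is a finite family $H$ of $d$-intervals, regarded as a hypergraph whose vertices are the points of $\mathbb{R}$ and whose edges are the members of $H$. A matching is a set of pairwise disjoint edges and $\nu(H)$ is its maximum size. A fractional cover is a finitely supported $g:\mathbb{R}\to\mathbb{R}_{\ge0}$ with $\sum_{v\in h}g(v)\ge1$ for every $h\in H$; $\tau^*(H)$ is the infimum of $\sum_v g(v)$ over fractional covers. *)

(* Defs.v *)
From Stdlib Require Import Reals List.
Import ListNotations.
Open Scope R_scope.

Definition in_interval (x : R) (ab : R * R) : bool :=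
  if Rle_dec (fst ab) x then (if Rle_dec x (snd ab) then true else false) else false.

(* A d-interval is represented by the list of its component closed intervals. *)
Definition dint := list (R * R).

Definition memb (x : R) (h : dint) : bool := existsb (in_interval x) h.

Definition intervals_disjoint (p q : R * R) : Prop :=
  snd p < fst q \/ snd q < fst p.

(* h is a d-interval: a union of at most d (and at least one, so edges are
   nonempty) pairwise disjoint closed intervals. *)
Definition is_d_interval (d : nat) (h : dint) : Prop :=
  (1 <= length h <= d)%nat /\
  Forall (fun ab => fst ab <= snd ab) h /\
  ForallOrdPairs intervals_disjoint h.

Definition hypergraph := list dint.

Definition is_d_hypergraph (d : nat) (H : hypergraph) : Prop :=
  Forall (is_d_interval d) H.

Definition edges_disjoint (h1 h2 : dint) : Prop :=
  ~ (exists x : R, memb x h1 = true /\ memb x h2 = true).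

Definition is_matching (H : hypergraph) (M : list nat) : Prop :=
  NoDup M /\ (forall i, In i M -> (i < length H)%nat) /\
  (forall i j, In i M -> In j M -> i <> j ->
     edges_disjoint (nth i H []) (nth j H [])).

Definition is_nu (H : hypergraph) (n : nat) : Prop :=
  (exists M, is_matching H M /\ length M = n) /\
  (forall M, is_matching H M -> (length M <= n)%nat).

(* A finitely supported g : R -> R_{>=0}, given as a finite list of
   (point, weight) pairs; g(v) is the sum of the weights attached to v. *)
Definition fsfun := list (R * R).

Definition total_weight (g : fsfun) : R :=
  fold_right (fun p acc => snd p + acc) 0 g.

Definition weight_on (g : fsfun) (h : dint) : R :=
  fold_right (fun p acc => (if memb (fst p) h then snd p else 0) + acc) 0 g.

Definition is_fractional_cover (H : hypergraph) (g : fsfun) : Prop :=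
  Forall (fun p => 0 <= snd p) g /\
  Forall (fun h => 1 <= weight_on g h) H.

Definition cover_values (H : hypergraph) (t : R) : Prop :=
  exists g, is_fractional_cover H g /\ total_weight g = t.

Definition is_glb (E : R -> Prop) (m : R) : Prop :=
  (forall x, E x -> m <= x) /\
  (forall m', (forall x, E x -> m' <= x) -> m' <= m).

Definition is_tau_star (H : hypergraph) (t : R) : Prop :=
  is_glb (cover_values H) t.

(* Main.v *)
(** For d >= 3 the bound exceeds 2 d nu, which follows from LP duality: otherwise there are
    edge weights w with total weight larger than 2 d nu times the largest weight of a point.
    Two edges meet only if one contains a left endpoint of the other, so the weighted number
    of meeting pairs is at most 2 d times that largest weight times the total weight, and the
    weighted Turan inequality yields a matching with more than nu edges.

    For d <= 2 one even has tau <= (d^2 - d + 1) nu (Tardos, Kaiser). If no n points cover the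
    edges, then every way of cutting the line at n points leaves some edge uncut. Give an edge
    the weight "distance to the nearest cut", and a segment between consecutive cuts the total
    weight of the edges that meet it. Labelling each cut vector by a heaviest segment, Sperner's
    lemma produces cuts for which the n + 1 segments have nearly equal weights. An uncut edge
    meets at most d segments, so the edges define a nearly perfect fractional matching of a
    graph with n + 1 vertices (only loops if d = 1), and such a graph has a matching with
    (n + 1) / 3 edges (n + 1 if d = 1). Edges meeting disjoint sets of segments are disjoint. *)

Require Import Defs.
From Stdlib Require Import Reals List Lra.
From mathcomp Require all_boot all_order all_algebra zify ring lra boolp Rstruct.
Open Scope R_scope.

Module Sperner.
Import all_boot zify.zify boolp.
Set Implicit Arguments.
Unset Strict Implicit.
Unset Printing Implicit Defensive.
Local Open Scope nat_scope.

(** * Sperner's lemma on the Kuhn triangulation *)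

Lemma even_card_involution (T : finType) (A : {set T}) (f : T -> T) :
  (forall x, x \in A -> [/\ f x \in A, f (f x) = x & f x != x]) -> ~~ odd #|A|.
Proof.
have [m] := ubnP #|A|; elim: m A => // m IHm A; rewrite ltnS => leAm fA.
have [->|[x Ax]] := set_0Vmem A; first by rewrite cards0.
have [Afx ffx fxx] := fA x Ax.
rewrite (cardsD1 x) Ax (cardsD1 (f x)) !inE fxx Afx /= negbK.
apply: IHm => [|y].
  by apply: leq_trans leAm; rewrite (cardsD1 x A) Ax (cardsD1 (f x) (A :\ x)) !inE fxx Afx; lia.
rewrite !inE => /and3P[ynfx ynx Ay]; have [Afy ffy fyy] := fA y Ay.
split=> //; rewrite Afy andbT; apply/andP; split; apply/eqP => E.
  by move: ynx; rewrite -ffy E ffx eqxx.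
by move: ynfx; rewrite -E ffy eqxx.
Qed.

(** If all labels occur, only the vertex labelled [k] can be removed. Otherwise, if some removal
    leaves the labels below [k], exactly two vertices share a label and either can be removed. *)
Lemma door_parity (k : nat) (f : 'I_k.+1 -> nat) :
  (forall t, f t <= k) ->
  odd #|[set j | [forall c : 'I_k, exists t, (t != j) && (f t == c)]]|
  = [forall c : 'I_k.+1, exists t, f t == c].
Proof.
move=> fk; pose g t := Ordinal (fk t : f t < k.+1).
set A := [set j | _]; case: (boolP [forall c, _]) => [/forallP full|nfull].
  have gT : g @: setT = setT.
    apply/setP => c; rewrite !inE; have /existsP[t /eqP E] := full c.
    by apply/imsetP; exists t => //; apply: val_inj.
  have ginj : {in setT &, injective g} by apply/imset_injP; rewrite gT.
  have /existsP[j0 /eqP fj0] := full ord_max.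
  suff -> : A = [set j0] by rewrite cards1.
  apply/setP => j; rewrite !inE; apply/forallP/eqP => [Aj|-> c].
    have jk : ~~ (f j < k).
      apply/negP => lt; have /existsP[t /andP[tj /eqP E]] := Aj (Ordinal lt).
      by move/eqP: tj; apply; apply: ginj => //; apply: val_inj.
    apply: ginj => //; apply: val_inj; rewrite /= fj0 /=.
    by have := fk j; lia.
  have /existsP[t /eqP E] := full (widen_ord (leqnSn k) c).
  apply/existsP; exists t; rewrite E eqxx andbT.
  by apply/eqP => tj; move: E; rewrite tj fj0 /=; case: c => c /=; lia.
have [->|[j Aj]] := set_0Vmem A; first by rewrite cards0.
have Ajc (c : nat) : c < k -> exists2 t, t != j & f t = c.
  move=> ck; move: Aj; rewrite inE => /forallP/(_ (Ordinal ck))/existsP[t].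
  by case/andP=> tj /eqP E; exists t.
have fltk t : f t < k.
  have := fk t; rewrite leq_eqVlt => /orP[/eqP E|//]; case/negP: nfull.
  apply/forallP => c; apply/existsP.
  have [ck|ck] := ltnP c k; first by have [u _ fu] := Ajc _ ck; exists u; rewrite fu.
  by exists t; rewrite E eqn_leq ck -ltnS ltn_ord.
have sub : [set c : 'I_k.+1 | c < k] \subset g @: [set~ j].
  apply/subsetP => c; rewrite inE => ck; have [t tj ft] := Ajc _ ck.
  by apply/imsetP; exists t; rewrite ?inE //; apply: val_inj.
have cK : #|[set c : 'I_k.+1 | c < k]| = k.
  have -> : [set c : 'I_k.+1 | c < k] = [set~ ord_max].
    by apply/setP => c; rewrite !inE -(inj_eq val_inj) /=; case: c => c /=; lia.
  by rewrite cardsC1 card_ord.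
have ginj : {in [set~ j] &, injective g}.
  apply/imset_injP; rewrite eqn_leq leq_imset_card /= cardsC1 card_ord /= -[X in X <= _]cK.
  exact: subset_leq_card.
have [i ij fi] := Ajc _ (fltk j).
suff -> : A = [set i; j] by rewrite cards2 ij.
apply/setP => l; rewrite in_set2; apply/idP/orP => [|[/eqP->|/eqP->//]].
  have [->|lj] := eqVneq l j; first by right.
  have [->|li] := eqVneq l i; first by left.
  rewrite inE => /forallP/(_ (Ordinal (fltk l)))/existsP[t /andP[tl /eqP /= E]].
  have [tj|tj] := eqVneq t j.
    case/eqP: li; apply: ginj; rewrite ?inE //; apply: val_inj => /=.
    by rewrite -E tj -fi.
  by case/eqP: tl; apply: ginj; rewrite ?inE //; apply: val_inj.
rewrite inE; apply/forallP => c; have [t tj ft] := Ajc c (ltn_ord c).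
apply/existsP; have [ti|ti] := eqVneq t i; last by exists t; rewrite ti ft eqxx.
by exists j; rewrite eq_sym ij -fi -ti ft eqxx.
Qed.

(** * Kuhn simplices and reflections in their facets *)

Definition kvtx (Y r : nat -> nat) (t i : nat) : nat := Y i + (r i < t).

(** The gaps between consecutive coordinates, starting from 0, are barycentric coordinates up to
    scaling, so this is the boundary condition of Sperner's lemma. *)
Definition segment_nonempty (Z : nat -> nat) (c : nat) : bool :=
  (if c is c'.+1 then Z c' else 0) < Z c.

(* The Kuhn simplex with vertices [kvtx Y r t], t <= k, inside the face of the simplex
   0 <= x_0 <= ... <= M where all coordinates of index >= k equal M; r gives the order in
   which the coordinates are incremented. *)
Record is_room (M k : nat) (Y r : nat -> nat) : Prop := IsRoom {
  room_top : forall i, k <= i -> Y i = M /\ r i = i;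
  room_lt : forall i, i < k -> r i < k;
  room_inj : forall i j, i < k -> j < k -> r i = r j -> i = j;
  room_sur : forall j, j < k -> exists2 i, i < k & r i = j;
  room_mono : forall t i, t <= k -> i.+1 < k -> kvtx Y r t i <= kvtx Y r t i.+1;
  room_bnd : forall i, i < k -> Y i < M }.

(** Reflection in the facet opposite to an intermediate vertex [j] transposes the ranks [j.-1] and
    [j]; for the two extreme vertices it shifts the first [K] ranks cyclically. *)
Definition swap_rank j m := if m == j then j.-1 else if m.+1 == j then j else m.
Definition dec_rank K m := if m < K then (if m == 0 then K.-1 else m.-1) else m.
Definition inc_rank K m := if m < K then (if m.+1 < K then m.+1 else 0) else m.

Ltac iflia :=
  move=> *;
  repeat match goal with
  | H : context [if ?b then _ else _] |- _ => destruct b eqn:?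
  | |- context [if ?b then _ else _] => destruct b eqn:?
  end; simpl in *; lia.

(** Only vertex [j] changes. It loses monotonicity only if coordinates [i] and [i.+1] have equal
    bases and ranks [j] and [j.-1]; then segment [i.+1] is nonempty at vertex [j] alone, against the
    hypothesis. *)
Lemma room_swap M k Y r j : is_room M k Y r -> 0 < j < k ->
  (forall c, c < k -> exists t, [/\ t <= k, t != j & segment_nonempty (kvtx Y r t) c]) ->
  is_room M k Y (swap_rank j \o r).
Proof.
move=> [top lt inj sur mono bnd] jk seg; rewrite /swap_rank; split => //=.
- by move=> i ki; have [-> ->] := top i ki; split=> //; iflia.
- by move=> i ik; have := lt i ik; iflia.
- by move=> a b ak bk E; apply: inj => //; move: E; iflia.
- move=> m mk; case: (sur (swap_rank j m)); first by rewrite /swap_rank; iflia.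
  by move=> i ik E; exists i => //; rewrite E /swap_rank; iflia.
- move=> t i tk ik; have := mono t i tk ik; rewrite /kvtx /=.
  have [->|tj] := eqVneq t j; last by iflia.
  move=> _; have j1 : j.-1 <= k by iflia. have j2 : j.+1 <= k by iflia.
  have := mono _ i j1 ik; have := mono _ i j2 ik; rewrite /kvtx.
  have [/eqP|] := boolP ((r i == j) && (r i.+1 == j.-1) && (Y i == Y i.+1)); last first.
    by have := inj i i.+1; iflia.
  move=> bad _ _; have [t' [t'k t'j]] := seg _ ik.
  by rewrite /segment_nonempty /kvtx; iflia.
Qed.

(** The base moves to vertex 1, and the coordinate of rank 0 is incremented once more at the end.
    This leaves the simplex only if that coordinate is [k] and its first increment reaches [M]; then
    the remaining facet is a room one dimension lower. *)
Lemma room_up M k Y r : is_room M k.+1 Y r ->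
  is_room M k.+1 (fun i => Y i + (r i == 0)) (dec_rank k.+1 \o r) \/
  is_room M k (fun i => Y i + (r i == 0)) (dec_rank k.+1 \o r).
Proof.
move=> [top lt inj sur mono bnd]; rewrite /dec_rank.
have mono' t i : t <= k -> i.+1 < k.+1 ->
    kvtx (fun i => Y i + (r i == 0)) (dec_rank k.+1 \o r) t i <=
    kvtx (fun i => Y i + (r i == 0)) (dec_rank k.+1 \o r) t i.+1.
  move=> tk ik; have := mono t.+1 i; rewrite /kvtx /dec_rank /=.
  by have := lt i; have := lt i.+1; iflia.
have top' i : k.+1 <= i -> Y i + (r i == 0) = M /\ dec_rank k.+1 (r i) = i.
  by move=> ki; have [-> ->] := top i ki; rewrite /dec_rank; split; iflia.
have inj' i j : i < k.+1 -> j < k.+1 -> dec_rank k.+1 (r i) = dec_rank k.+1 (r j) -> i = j.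
  move=> ik jk E; apply: inj => //; move: E; rewrite /dec_rank.
  by have := lt i ik; have := lt j jk; iflia.
have sur' j : j < k.+1 -> exists2 i, i < k.+1 & dec_rank k.+1 (r i) = j.
  move=> jk; have [|i ik E] := sur (inc_rank k.+1 j); first by rewrite /inc_rank; iflia.
  by exists i => //; rewrite E /inc_rank /dec_rank; iflia.
have lt' i : i < k.+1 -> dec_rank k.+1 (r i) < k.+1.
  by move=> ik; have := lt i ik; rewrite /dec_rank; iflia.
have [a ak ra] := sur 0 isT.
have Va i : i < k.+1 -> Y i + (r i == 0) <= M by move=> ik; have := bnd i ik; iflia.
have eqa i : i < k.+1 -> r i = 0 -> i = a by move=> ik ri; apply: inj => //; rewrite ri ra.
have [/andP[/eqP ek /eqP eY]|nb] := boolP ((a == k) && ((Y a).+1 == M)).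
  right; split.
  - move=> i; rewrite leq_eqVlt => /orP[/eqP <-|]; last exact: top'.
    by rewrite /= -ek ra; split; move: eY; clear; iflia.
  - move=> i ik; have ik1 : i < k.+1 by iflia.
    by have := lt' i ik1; have := eqa i ik1; rewrite /dec_rank /=; iflia.
  - by move=> i j ik jk; apply: inj'; iflia.
  - move=> j jk; have [|i ik E] := sur' j; first by iflia.
    exists i => //; have [//|ki] := ltnP i k.
    have ia : i = a by iflia.
    by move: E; rewrite ia ra /dec_rank; iflia.
  - by move=> t i tk ik; apply: mono'; iflia.
  - move=> i ik; have ik1 : i < k.+1 by iflia.
    have := bnd i ik1; have := eqa i ik1; iflia.
left; split=> //.
- move=> t i tk ik; have [tk'|kt] := leqP t k; first exact: mono'.
  have {kt tk}-> : t = k.+1 by iflia.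
  have i1 : i < k.+1 by iflia.
  have := mono 1 i; have := mono k.+1 i; rewrite /kvtx /=.
  have := lt' _ ik; have := lt' _ i1; have := lt _ ik; have := lt _ i1; iflia.
- move=> i ik; have [ri|ri] := eqVneq (r i) 0; last by have := bnd i ik; iflia.
  have ia := eqa i ik ri; rewrite ia; have Ya := bnd a ak.
  have [ak1|ka] := eqVneq a k; first by move: nb; rewrite ak1 eqxx -ak1 /=; iflia.
  have := mono 1 a; rewrite /kvtx /=; have a1 : a.+1 < k.+1 by iflia.
  by have := bnd _ a1; have := eqa _ a1; iflia.
Qed.

(** The hypotheses concern only the facet of vertices [0..k], so they cover both a facet of a room
    of dimension [k.+1] and a room of dimension [k]. *)
Lemma room_down M k Y r :
  0 < M ->
  (forall i, k.+1 <= i -> Y i = M /\ r i = i) ->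
  (forall i, i < k.+1 -> r i < k.+1) ->
  (forall i j, i < k.+1 -> j < k.+1 -> r i = r j -> i = j) ->
  (forall j, j < k.+1 -> exists2 i, i < k.+1 & r i = j) ->
  (forall t i, t <= k -> i.+1 < k.+1 -> kvtx Y r t i <= kvtx Y r t i.+1) ->
  (forall i, i < k.+1 -> kvtx Y r k i <= M) ->
  (forall c, c < k.+1 -> exists2 t, t <= k & segment_nonempty (kvtx Y r t) c) ->
  is_room M k.+1 (fun i => Y i - (r i == k)) (inc_rank k.+1 \o r) /\
  (forall i, r i = k -> 0 < Y i).
Proof.
move=> M0 top lt inj sur mono bnd seg; rewrite /inc_rank.
(* If the coordinate to be decremented were 0, all earlier ones would vanish on the facet and
   segment 0 would be empty there. *)
have pos i : r i = k -> 0 < Y i.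
  move=> ri; have [ik|ki] := ltnP i k.+1; last by have [-> _] := top i ki.
  rewrite lt0n; apply/eqP => Yi; have [t tk] := seg 0 isT.
  rewrite /segment_nonempty; suff -> : kvtx Y r t 0 = 0 by [].
  have H j : j <= i -> kvtx Y r t (i - j) = 0.
    elim: j => [|j IHj] ji; first by rewrite subn0 /kvtx ri Yi; iflia.
    have := mono t (i - j.+1) tk; have -> : (i - j.+1).+1 = i - j by iflia.
    by rewrite IHj; iflia.
  by have := H i (leqnn i); rewrite subnn.
split=> //; split.
- by move=> i ki /=; have [-> ->] := top i ki; split; iflia.
- by move=> i ik /=; have := lt i ik; iflia.
- move=> i j ik jk /= E; apply: inj => //; move: E.
  by have := lt i ik; have := lt j jk; iflia.
- move=> j jk; have [|i ik E] := sur (dec_rank k.+1 j); first by rewrite /dec_rank; iflia.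
  by exists i => //=; rewrite E /dec_rank; iflia.
- move=> [|t] i tk ik; have i1 : i < k.+1 by iflia.
    rewrite /kvtx !ltn0 !addn0; have := mono 0 i isT ik; rewrite /kvtx !ltn0 !addn0.
    (* At the new base, order can break only where [Y i = Y i.+1] and coordinate [i.+1] is
       decremented; then segment [i.+1] is empty on the whole facet. *)
    have [ri|] := eqVneq (r i.+1) k; last by iflia.
    have := inj i i.+1 i1 ik; rewrite ri => inji le.
    have rik : r i != k by iflia.
    have [e|] := eqVneq (Y i) (Y i.+1); last by iflia.
    have [t tk'] := seg _ ik; rewrite /segment_nonempty /=.
    by have := mono t i tk' ik; rewrite /kvtx; iflia.
  have := mono t i; rewrite /kvtx /=.
  have := lt _ ik; have := lt _ i1; have := pos i; have := pos i.+1; iflia.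
- move=> i ik /=; have := bnd i ik; rewrite /kvtx; have := pos i; have := lt i ik; iflia.
Qed.

Lemma kvtx_swap Y r j t : 0 < j -> t != j -> kvtx Y (swap_rank j \o r) t = kvtx Y r t.
Proof. by move=> j0 tj; apply: funext => i; rewrite /kvtx /swap_rank /=; iflia. Qed.

Lemma kvtx_up Y r k t : t <= k ->
  kvtx (fun i => Y i + (r i == 0)) (dec_rank k.+1 \o r) t = kvtx Y r t.+1.
Proof. by move=> tk; apply: funext => i; rewrite /kvtx /dec_rank /=; iflia. Qed.

Lemma kvtx_down Y r k t : (forall i, r i = k -> 0 < Y i) -> t <= k ->
  kvtx (fun i => Y i - (r i == k)) (inc_rank k.+1 \o r) t.+1 = kvtx Y r t.
Proof.
move=> pos tk; apply: funext => i; have := pos i.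
by rewrite /kvtx /inc_rank /=; iflia.
Qed.

(** * Parity of the number of fully labelled rooms *)

Section Sperner.

Variables (n M : nat) (lab : (nat -> nat) -> nat).
Hypothesis M_gt0 : 0 < M.
Hypothesis labP : forall Z : nat -> nat,
  (forall i, Z i <= Z i.+1) -> (forall i, n <= i -> Z i = M) ->
  segment_nonempty Z (lab Z).

Local Notation room := ({ffun 'I_n -> 'I_M.+1} * {ffun 'I_n -> 'I_n.+1})%type.

(** Rooms form a finite type so that they can be counted. Only [n] coordinates are stored; the
    defaults [M] and [i] are the values prescribed by [room_top]. *)
Definition room_base (R : room) (i : nat) : nat := oapp (fun j => val (R.1 j)) M (insub i).
Definition room_rank (R : room) (i : nat) : nat := oapp (fun j => val (R.2 j)) i (insub i).
Definition mk_room (Y r : nat -> nat) : room :=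
  ([ffun i : 'I_n => inord (Y i)], [ffun i : 'I_n => inord (r i)]).

Lemma mk_roomK k Y r : k <= n -> is_room M k Y r ->
  room_base (mk_room Y r) = Y /\ room_rank (mk_room Y r) = r.
Proof.
move=> kn [top lt _ _ _ bnd].
split; apply: funext => i; rewrite /room_base /room_rank;
  case: insubP => [j _ <-|] /=; rewrite ?ffunE -?leqNgt.
- rewrite inordK // ltnS; by have [/bnd/ltnW//|/top[-> _]] := ltnP j k.
- by move=> ni; have [|->] := top i _; first exact: leq_trans ni.
- rewrite inordK // ltnS; have [/lt|/top[_ ->]] := ltnP j k; last exact/ltnW.
  by move=> /ltnW/leq_trans; apply.
- by move=> ni; have [|_ ->] := top i _; first exact: leq_trans ni.
Qed.

Lemma mk_room_id R : mk_room (room_base R) (room_rank R) = R.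
Proof.
case: R => y r; congr (_, _); apply/ffunP => i; rewrite ffunE;
  by rewrite /room_base /room_rank valK /= inord_val.
Qed.

Definition roomb k (R : room) : bool := `[< is_room M k (room_base R) (room_rank R) >].
Definition room_lab (R : room) (t : nat) : nat := lab (kvtx (room_base R) (room_rank R) t).
Definition full_room k (R : room) : bool :=
  roomb k R && [forall c : 'I_k.+1, exists t : 'I_k.+1, room_lab R t == c].
(** A facet is named by a room and its opposite vertex, so a facet shared by two rooms is counted
    once from each. *)
Definition door k (d : room * 'I_k.+1) : bool :=
  roomb k d.1 && [forall c : 'I_k, exists t, (t != d.2) && (room_lab d.1 t == c)].

Lemma kvtx_mono k Y r t : is_room M k Y r -> t <= k ->
  forall i, kvtx Y r t i <= kvtx Y r t i.+1.
Proof.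
move=> [top lt inj sur mono bnd] tk i; have [ik|ki] := ltnP i.+1 k; first exact: mono.
have [E1 E2] := top _ ki; rewrite /kvtx E1.
have [/bnd|ki'] := ltnP i k; first by lia.
by have [-> ->] := top _ ki'; lia.
Qed.

Lemma kvtx_top k Y r t : k <= n -> is_room M k Y r -> t <= k ->
  forall i, n <= i -> kvtx Y r t i = M.
Proof.
move=> kn [top _ _ _ _ _] tk i ni.
by rewrite /kvtx; have [|-> ->] := top i _; lia.
Qed.

Lemma lab_segment k Y r t : k <= n -> is_room M k Y r -> t <= k ->
  segment_nonempty (kvtx Y r t) (lab (kvtx Y r t)).
Proof.
by move=> kn rm tk; apply: labP; [apply: kvtx_mono rm tk | apply: kvtx_top rm tk].
Qed.

(** In a face of dimension [k] all coordinates from [k] on equal [M], so the later segments are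
    empty and cannot be labels. *)
Lemma lab_le k Y r t : k <= n -> is_room M k Y r -> t <= k -> lab (kvtx Y r t) <= k.
Proof.
move=> kn rm tk; have := lab_segment kn rm tk; rewrite /segment_nonempty.
case: (lab _) => // c; rewrite ltnNge; apply: contraR; rewrite -ltnNge ltnS => kc.
case: rm => top _ _ _ _ _; rewrite /kvtx.
have [-> ->] := top _ kc; have [|-> ->] := top c.+1 _; lia.
Qed.

Lemma card_doors_parity k : k <= n ->
  odd #|[set d | @door k d]| = odd #|[set R | full_room k R]|.
Proof.
move=> kn; pose D R := #|[set j | @door k (R, j)]|.
have -> : #|[set d | @door k d]| = \sum_R D R.
  rewrite -sum1_card; rewrite (partition_big fst xpredT) //=; apply: eq_bigr => R _.
  rewrite /D -sum1_card (reindex_onto (fun j => (R, j)) snd) /=; last first.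
    by move=> [R' j] /andP[_ /eqP /= ->].
  by apply: eq_bigl => j; rewrite !inE !eqxx !andbT.
rewrite -sum1_card [X in _ = odd X]big_mkcond /=.
rewrite !(big_morph odd oddD (erefl _ : odd 0 = false)); apply: eq_bigr => R _.
rewrite inE /D /full_room /door /=.
case: (boolP (roomb k R)) => /= [/asboolP rm|_]; last first.
  by rewrite (_ : [set _ | _] = set0) ?cards0 //; apply/setP => j; rewrite !inE.
rewrite (door_parity (f := fun t : 'I_k.+1 => room_lab R t)); first by case: ifP.
by move=> t; apply: lab_le rm _ => //; rewrite -ltnS.
Qed.

Section Flip.
Variable k : nat.
Hypothesis kn : k.+1 <= n.

Definition up_room (R : room) : room :=
  mk_room (fun i => room_base R i + (room_rank R i == 0)) (dec_rank k.+1 \o room_rank R).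
Definition down_room (R : room) : room :=
  mk_room (fun i => room_base R i - (room_rank R i == k)) (inc_rank k.+1 \o room_rank R).
Definition swap_room j (R : room) : room :=
  mk_room (room_base R) (swap_rank j \o room_rank R).

(* Reflection in the facet opposite to vertex d.2. If it leaves the big simplex, then the facet
   lies in the face of dimension k, and [up_room] yields exactly that facet as a room. *)
Definition flip (d : room * 'I_k.+2) : room * 'I_k.+2 :=
  if d.2 == ord0 then (up_room d.1, ord_max)
  else if d.2 == ord_max then (down_room d.1, ord0)
  else (swap_room d.2 d.1, d.2).

Lemma up_roomP R : roomb k.+1 R -> 
  [/\ roomb k.+1 (up_room R) || roomb k (up_room R),
      down_room (up_room R) = R &
      forall t, t <= k -> room_lab (up_room R) t = room_lab R t.+1].
Proof.
move/asboolP => rm; have rm' := room_up rm.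
have [E1 E2] : room_base (up_room R) = (fun i => room_base R i + (room_rank R i == 0)) /\
    room_rank (up_room R) = dec_rank k.+1 \o room_rank R.
  by case: rm' => /mk_roomK; apply=> //; exact: ltnW.
split.
- by case: rm' => rm'; apply/orP; [left|right]; apply/asboolP; rewrite E1 E2.
- rewrite /down_room E1 E2 -[RHS]mk_room_id; congr mk_room; apply: funext => i;
  by rewrite /= /dec_rank /inc_rank; iflia.
- by move=> t tk; rewrite /room_lab E1 E2 kvtx_up.
Qed.

(** The second alternative reads a full room of dimension [k] as a boundary facet of the simplex of
    dimension [k.+1]; the result is the room behind it. *)
Lemma down_roomP R :
  (roomb k.+1 R /\ forall c, c < k.+1 -> exists2 t, t <= k & room_lab R t = c) \/
  full_room k R ->
  [/\ roomb k.+1 (down_room R), up_room (down_room R) = R &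
      forall t, t <= k -> room_lab (down_room R) t.+1 = room_lab R t].
Proof.
set Y := room_base R; set r := room_rank R => RH.
have [rm' pos] : is_room M k.+1 (fun i => Y i - (r i == k)) (inc_rank k.+1 \o r) /\
    (forall i, r i = k -> 0 < Y i).
  case: RH => [[/asboolP rm labs]|/andP[/asboolP rm /forallP labs]].
    move: (rm) => []; rewrite -/Y -/r => top lt inj sur mono bnd; apply: room_down => //.
    - by move=> t i tk; apply: mono; lia.
    - by move=> i /bnd; rewrite /kvtx; lia.
    - move=> c /labs[t tk <-]; exists t => //; apply: lab_segment rm _ => //; exact: leqW.
  move: (rm) => []; rewrite -/Y -/r => top lt inj sur mono bnd.
  (* Coordinate [k] equals [M] and has rank [k], so it is the one to be lowered. *)
  have rk i : i < k.+1 -> (i == k) = (r i == k).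
    move=> ik; have [->|ink] := eqVneq i k; first by have [|_ ->] := top k _; rewrite // eqxx.
    by have := lt i; lia.
  apply: room_down => //.
  - by move=> i ki; apply: top; lia.
  - move=> i ik; have := rk i ik; have := lt i; lia.
  - move=> i j ik jk E; have := rk i ik; have := rk j jk; have := inj i j; rewrite E; lia.
  - move=> j jk; have [jk'|kj] := ltnP j k; last by exists k => //; have [|_ E] := top k _; lia.
    by have [i ik E] := sur j jk'; exists i => //; lia.
  - by move=> t i tk _; apply: kvtx_mono rm tk i.
  - move=> i ik; have [|ki] := ltnP i k; first by move/bnd; rewrite /kvtx; lia.
    by rewrite /kvtx; have [E1 E2] := top i ki; lia.
  - move=> c ck; have /existsP[t /eqP /= <-] := labs (Ordinal ck).
    by exists t; [rewrite -ltnS | apply: lab_segment rm _; [lia|rewrite -ltnS]].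
have [E1 E2] := mk_roomK kn rm'; rewrite -/Y -/r in E1 E2; split.
- by apply/asboolP; rewrite E1 E2.
- rewrite /up_room E1 E2 -[RHS]mk_room_id; congr mk_room; apply: funext => i;
  rewrite /= -/Y -/r; have := pos i; rewrite /dec_rank /inc_rank; iflia.
- by move=> t tk; rewrite /room_lab E1 E2 kvtx_down.
Qed.

Lemma swap_roomP R (j : nat) : roomb k.+1 R -> 0 < j < k.+1 ->
  (forall c, c < k.+1 -> exists t, [/\ t <= k.+1, t != j & room_lab R t = c]) ->
  [/\ roomb k.+1 (swap_room j R), swap_room j (swap_room j R) = R,
      swap_room j R != R &
      forall t, t != j -> room_lab (swap_room j R) t = room_lab R t].
Proof.
move=> /asboolP rm jk labs.
have rm' : is_room M k.+1 (room_base R) (swap_rank j \o room_rank R).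
  apply: (room_swap rm jk) => c /labs[t [tk tj <-]]; exists t; split=> //.
  exact: lab_segment rm tk.
have [E1 E2] := mk_roomK kn rm'; split.
- by apply/asboolP; rewrite E1 E2.
- rewrite /swap_room E1 E2 -[RHS]mk_room_id; congr mk_room; apply: funext => i.
  by rewrite /= /swap_rank; iflia.
- have [i ik ri] := room_sur rm (andP jk).2; apply/eqP => E.
  have : room_rank (swap_room j R) i = room_rank R i by rewrite E.
  by rewrite E2 /= ri /swap_rank; iflia.
- by move=> t tj; rewrite /room_lab E1 E2 kvtx_swap //; lia.
Qed.

Lemma flip_door d : door d ->
  [/\ flip (flip d) = d, flip d != d,
      roomb k.+1 (flip d).1 -> door (flip d) &
      ~~ roomb k.+1 (flip d).1 -> d.2 == ord0 /\ full_room k (flip d).1].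
Proof.
case: d => R j /andP[/= rm /forallP labs].
have labs' c : c < k.+1 -> exists t, [/\ t <= k.+1, t != j & room_lab R t = c].
  move=> ck; have /existsP[t /andP[tj /eqP E]] := labs (Ordinal ck).
  by exists t; split=> //; rewrite -ltnS.
rewrite /flip /=; have [j0|j0] := eqVneq j ord0.
  have [or upK lt] := up_roomP rm; rewrite /= eqxx upK j0; split=> //.
  - by apply/eqP => -[].
  - move=> rm'; rewrite /door /= rm'; apply/forallP => c.
    have [[|t] [tk tj <-]] := labs' c (ltn_ord c); first by move: tj; rewrite j0.
    have tlt : t < k.+2 by lia.
    apply/existsP; exists (Ordinal tlt); rewrite lt // eqxx andbT.
    by rewrite -(inj_eq val_inj) /=; lia.
  - move=> nrm; split => //; move: or; rewrite (negbTE nrm) /= => rm'.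
    rewrite /full_room rm'; apply/forallP => c.
    have [[|t] [tk tj <-]] := labs' c (ltn_ord c); first by move: tj; rewrite j0.
    have tlt : t < k.+1 by lia.
    by apply/existsP; exists (Ordinal tlt); rewrite lt.
have [jm|jm] := eqVneq j ord_max.
  have [|rm' downK lt] := @down_roomP R.
    left; split=> // c /labs'[t [tk tj E]]; exists t => //.
    by move: tj; rewrite jm /=; lia.
  rewrite /= downK jm; split=> //.
  - by apply/eqP => -[].
  - move=> _; rewrite /door /= rm'; apply/forallP => c.
    have [t [tk tj <-]] := labs' c (ltn_ord c).
    have tk' : t <= k by move: tj; rewrite jm /=; lia.
    have tlt : t.+1 < k.+2 by lia.
    by apply/existsP; exists (Ordinal tlt); rewrite lt // eqxx andbT.
  - by rewrite rm'.
have jk : 0 < j < k.+1.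
  by move: j0 jm; rewrite -!(inj_eq val_inj) /=; case: (j) => m /=; lia.
have [rm' swK ne lt] := swap_roomP rm jk labs'.
rewrite /= (negbTE j0) (negbTE jm) /= swK; split=> //.
- by apply/eqP => -[/eqP]; rewrite (negbTE ne).
- move=> _; rewrite /door /= rm'; apply/forallP => c.
  have /existsP[t /andP[tj E]] := labs c.
  by apply/existsP; exists t; rewrite lt // tj.
- by rewrite rm'.
Qed.

(** Doors whose reflection is again a room of dimension [k.+1] are paired by [flip], so only the
    boundary doors count modulo 2. These correspond to the full rooms of dimension [k]. *)
Lemma card_full_rooms_step :
  odd #|[set R | full_room k.+1 R]| = odd #|[set R | full_room k R]|.
Proof.
rewrite -card_doors_parity //.
set D := [set d | _]; pose B := [set d in D | ~~ roomb k.+1 (flip d).1].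
have -> : odd #|D| = odd #|B|.
  rewrite -(cardsID B D) oddD.
  have -> : D :&: B = B by apply/setIidPr/subsetP => d; rewrite inE => /andP[].
  suff /negbTE-> : ~~ odd #|D :\: B| by rewrite addbF.
  apply: (even_card_involution (f := flip)) => d.
  rewrite !inE => /andP[+ dd]; rewrite dd negbK => rm.
  have [fK ne df _] := flip_door dd.
  by rewrite fK df //= negbK; move: (dd) => /andP[->].
have injB : {in B &, injective (fun d => (flip d).1)}.
  move=> d d'; rewrite !inE => /andP[dd nd] /andP[dd' nd'] E.
  have [fK _ _ /(_ nd)[/eqP j0 _]] := flip_door dd.
  have [fK' _ _ /(_ nd')[/eqP j0' _]] := flip_door dd'.
  rewrite -fK -fK'; congr flip.
  by move: E; rewrite /flip j0 j0' eqxx /= => ->.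
rewrite -(card_in_imset injB); congr (odd #|pred_of_set _|).
apply/setP => R; apply/imsetP/idP => [[d]|].
  rewrite !inE => /andP[dd nd] ->.
  by have [_ _ _ /(_ nd)[_]] := flip_door dd.
rewrite inE => fR; have [|rm downK lt] := @down_roomP R; first by right.
exists (down_room R, ord0); last by rewrite /flip /= downK.
rewrite !inE /door /flip /= downK rm /=; apply/andP; split.
  apply/forallP => c; case/andP: fR => _ /forallP/(_ c)/existsP[t /eqP E].
  apply/existsP; exists (lift ord0 t); rewrite /= /bump /= add1n lt ?E ?eqxx //.
  by rewrite -ltnS.
case/andP: fR => /asboolP[/(_ k (leqnn k))[E _] _ _ _ _ _] _.
by apply/negP => /asboolP[_ _ _ _ _ /(_ k (leqnn k.+1))]; rewrite E ltnn.
Qed.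

End Flip.

Lemma card_full_rooms_odd k : k <= n -> odd #|[set R | full_room k R]|.
Proof.
elim: k => [_|k IHk kn]; last by rewrite card_full_rooms_step // IHk // ltnW.
(* In dimension 0 the only room is the point with all coordinates [M], and its label must be 0. *)
have rm0 : is_room M 0 (fun=> M) id by split.
have [E1 E2] := mk_roomK (leq0n n) rm0.
rewrite (_ : [set _ | _] = [set mk_room (fun=> M) id]) ?cards1 //.
apply/setP => R; rewrite !inE; apply/andP/eqP => [[/asboolP rm _]|->].
  rewrite -[LHS]mk_room_id; congr mk_room; apply: funext => i;
  by have [] := room_top rm (leq0n i).
split; first by apply/asboolP; rewrite E1 E2.
apply/forallP => c; apply/existsP; exists ord0; rewrite (ord1 c) -leqn0.
by rewrite /room_lab E1 E2; apply: lab_le rm0 _.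
Qed.

(** The vertices of a full room of dimension [n] lie in the unit cube above its base. *)
Theorem sperner : exists Y : nat -> nat, forall c, c <= n -> exists Z : nat -> nat,
  [/\ forall i, Z i <= Z i.+1, forall i, n <= i -> Z i = M,
      forall i, Y i <= Z i <= (Y i).+1 & lab Z = c].
Proof.
have [E|[R]] := set_0Vmem [set R | full_room n R].
  by have := card_full_rooms_odd (leqnn n); rewrite E cards0.
rewrite inE => /andP[/asboolP rm /forallP labs].
exists (room_base R) => c cn; have /existsP[t /eqP E] := labs (Ordinal (cn : c < n.+1)).
have tn : t <= n by rewrite -ltnS.
exists (kvtx (room_base R) (room_rank R) t); split=> //.
- exact: kvtx_mono rm tn.
- exact: kvtx_top rm tn.
- by move=> i; rewrite /kvtx; lia.
Qed.

End Sperner.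

End Sperner.

Module BalancedCuts.
Import all_boot zify.zify Sperner.
Set Implicit Arguments.
Unset Strict Implicit.
Unset Printing Implicit Defensive.
Local Open Scope nat_scope.

(** * Cuts with nearly equal segment weights *)

Lemma leq_foldr_minn v M s : (v <= foldr minn M s) = (v <= M) && all (leq v) s.
Proof. by elim: s => [|x s IHs] /=; rewrite ?andbT // leq_min IHs andbCA. Qed.

Lemma count_initial_segment (p : pred nat) n j :
  (forall i, p i.+1 -> p i) -> j < n -> p j = (j < count p (iota 0 n)).
Proof.
move=> pd; have pd' i l : p (i + l) -> p i.
  by elim: l => [|l IHl]; rewrite ?addn0 // addnS => /pd/IHl.
elim: n => // n IHn; rewrite ltnS => jn.
have -> : iota 0 n.+1 = iota 0 n ++ [:: n] by rewrite -[n.+1]addn1 iotaD.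
rewrite count_cat /= addn0.
have [pn|npn] := boolP (p n).
  have allp : all p (iota 0 n).
    by apply/allP => i; rewrite mem_iota => /andP[_ il]; apply: (pd' i (n - i));
      rewrite subnKC //; lia.
  move: (allp); rewrite all_count => /eqP->; rewrite size_iota.
  have -> : p j by apply: (pd' j (n - j)); rewrite subnKC.
  by lia.
rewrite addn0; move: jn; rewrite leq_eqVlt => /orP[/eqP->|]; last exact: IHn.
by rewrite (negbTE npn); have := count_size p (iota 0 n); rewrite size_iota; lia.
Qed.

(** For [a <= b] the truncated differences add up to the distance from [z] to the scaled interval,
    and the quotient is [z] rounded to the nearest multiple of [2 * G]. *)
Lemma round_near G a b z : 0 < G -> (2 * G * a - z) + (z - 2 * G * b) < G ->
  a <= (z + G) %/ (2 * G) <= b.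
Proof.
move=> G0 lt; have L0 : 0 < 2 * G by lia.
by apply/andP; split; [rewrite leq_divRL //|rewrite -ltnS ltn_divLR //]; nia.
Qed.

Section BalancedCut.

Variables (m n K G : nat) (E : 'I_m -> seq (nat * nat)).
Hypothesis E_bounded : forall e ab, ab \in E e -> 0 < ab.1 <= ab.2 /\ ab.2 <= K.
Hypothesis E_nonempty : forall e, E e != [::].
Hypothesis E_no_cover : forall p : nat -> nat,
  exists e, forall ab, ab \in E e -> forall j, j < n -> ~~ (ab.1 <= p j <= ab.2).
Hypothesis G_gt0 : 0 < G.

(** Scaling by a large [2 * G] makes moving a cut by one unit negligible; [M] is the right end of
    the line, beyond every scaled endpoint. *)
Let L := 2 * G.
Let M := L * K.+1.

Definition cut_gap (z : nat) (ab : nat * nat) : nat := (L * ab.1 - z) + (z - L * ab.2).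
(** The default [M] caps the distance and is its value when there are no cuts. *)
Definition cut_dist (Z : nat -> nat) (e : 'I_m) : nat :=
  foldr minn M [seq cut_gap (Z j) ab | j <- iota 0 n, ab <- E e].
Definition cut_seg (Z : nat -> nat) (a : nat) : nat :=
  count (fun j => Z j < L * a) (iota 0 n).
(** Left endpoints suffice, since an interval that contains no cut lies within one segment. *)
Definition cut_segs (Z : nat -> nat) (e : 'I_m) : {set 'I_n.+1} :=
  [set i in [seq inord (cut_seg Z ab.1) | ab <- E e]].
Definition cut_load (Z : nat -> nat) (i : 'I_n.+1) : nat :=
  \sum_(e | i \in cut_segs Z e) cut_dist Z e.
Definition cut_lab (Z : nat -> nat) : nat := [arg max_(i > ord0) cut_load Z i].

Lemma leq_cut_dist v Z e : reflect
  (v <= M /\ forall j ab, j < n -> ab \in E e -> v <= cut_gap (Z j) ab)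
  (v <= cut_dist Z e).
Proof.
rewrite leq_foldr_minn; apply: (iffP andP) => -[vM H]; split=> //.
  move=> j ab jn abE; apply: (allP H); apply/allpairsP; exists (j, ab).
  by rewrite mem_iota.
apply/allP => _ /allpairsP[[j ab] [/= + abE ->]].
by rewrite mem_iota => /andP[_ jn]; apply: H.
Qed.

Lemma cut_seg_le Z a : cut_seg Z a < n.+1.
Proof.
by rewrite ltnS; have := count_size (fun j => Z j < L * a) (iota 0 n); rewrite size_iota.
Qed.

Lemma cut_segsP Z e (i : 'I_n.+1) :
  reflect (exists2 ab, ab \in E e & cut_seg Z ab.1 = i) (i \in cut_segs Z e).
Proof.
rewrite inE; apply: (iffP mapP) => -[ab abE H]; exists ab => //.
  by rewrite H inordK // cut_seg_le.
by apply: val_inj; rewrite /= inordK ?cut_seg_le.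
Qed.

Lemma cut_labP Z (i : 'I_n.+1) :
  exists2 l : 'I_n.+1, cut_lab Z = l & cut_load Z i <= cut_load Z l.
Proof. by rewrite /cut_lab; case: arg_maxnP => //= l _ H; exists l => //; apply: H. Qed.

Lemma G_le_M : G <= M.
Proof. by rewrite /M /L; nia. Qed.

(* If every edge came within G of a cut, rounding the cuts to multiples of 2 G would cover
   all edges. *)
Lemma cut_far Z : exists e, G <= cut_dist Z e.
Proof.
have [e He] := E_no_cover (fun j => (Z j + G) %/ L); exists e.
apply/leq_cut_dist; split=> [|j ab jn abE]; first exact: G_le_M.
have := He _ abE _ jn; apply: contraR; rewrite -ltnNge /cut_gap => lt.
exact: round_near lt.
Qed.

Lemma cut_load_far Z : exists i, G <= cut_load Z i.
Proof.
have [e Ge] := cut_far Z; case Ee: (E e) (E_nonempty e) => [//|ab s] _.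
exists (Ordinal (cut_seg_le Z ab.1)).
rewrite /cut_load (bigD1 e) /=; first exact: leq_trans Ge (leq_addr _ _).
by apply/cut_segsP; exists ab; rewrite ?Ee ?mem_head.
Qed.

(** A heaviest segment has positive load, hence meets an edge at positive distance from all cuts; a
    scaled left endpoint of that edge lies strictly between the ends of the segment. *)
Lemma cut_lab_segment Z :
  (forall i, Z i <= Z i.+1) -> (forall i, n <= i -> Z i = M) ->
  segment_nonempty Z (cut_lab Z).
Proof.
move=> Zmono Ztop; have [i Gi] := cut_load_far Z.
have [l El il] := cut_labP Z i; rewrite El.
have [e /cut_segsP[ab abE seg]] : exists2 e, l \in cut_segs Z e & 0 < cut_dist Z e.
  have : 0 < cut_load Z l by apply: leq_trans G_gt0 (leq_trans Gi il).
  rewrite lt0n /cut_load sum_nat_eq0 negb_forall => /existsP[e].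
  by rewrite negb_imply -lt0n => /andP[le d0]; exists e.
move=> /leq_cut_dist[_ dist].
have [/andP[a0 ab_le] bK] := E_bounded abE.
have low j : j < n -> (Z j < L * ab.1) = (j < l).
  move=> jn; rewrite -seg; apply: (@count_initial_segment (fun j => Z j < L * ab.1)) => // i'.
  by apply: leq_ltn_trans.
have LM : L * ab.2 < M by rewrite /M /L; nia.
have Zl : L * ab.1 < Z l.
  have [nl|ln] := leqP n l; first by rewrite Ztop // (leq_ltn_trans _ LM) // leq_mul2l ab_le orbT.
  have := low _ ln; have := dist _ _ ln abE; rewrite ltnn /cut_gap.
  have : L * ab.1 <= L * ab.2 by rewrite leq_mul2l ab_le orbT.
  by move: (L * ab.1) (L * ab.2) => A B; lia.
rewrite /segment_nonempty; case El': (val l) (Zl) => [|l'] Zl' /=.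
  exact: leq_ltn_trans Zl'.
have l'n : l' < n by rewrite -ltnS -El' ltn_ord.
by apply: ltn_trans Zl'; rewrite low //= El'.
Qed.

(** Each distance changes by at most 1. An edge at distance more than 2 keeps its segments, and any
    other edge contributes at most 2. *)
Lemma cut_load_lipschitz Z Z' i :
  (forall j, Z j <= (Z' j).+1 /\ Z' j <= (Z j).+1) ->
  cut_load Z i <= cut_load Z' i + 2 * m.
Proof.
move=> ZZ'; rewrite /cut_load !(big_mkcond (fun e => i \in _)) /=.
have -> : 2 * m = \sum_(e < m) 2 by rewrite sum_nat_const card_ord mulnC.
rewrite -big_split /=; apply: leq_sum => e _.
have [small|big] := leqP (cut_dist Z e) 2.
  by case: ifP => // _; apply: leq_trans small (leq_addl _ _).
have /leq_cut_dist[dM dist] := leqnn (cut_dist Z e).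
have -> : (i \in cut_segs Z' e) = (i \in cut_segs Z e).
  rewrite /cut_segs !inE; suff /eq_in_map-> :
    {in E e, (fun ab => inord (cut_seg Z' ab.1) : 'I_n.+1) =1
             fun ab => inord (cut_seg Z ab.1)} by [].
  move=> ab abE; congr inord.
  apply: eq_in_count => j; rewrite mem_iota => /andP[_ jn].
  have [/andP[_ ab_le] _] := E_bounded abE.
  have : L * ab.1 <= L * ab.2 by rewrite leq_mul2l ab_le orbT.
  have := dist _ _ jn abE; have := ZZ' j; rewrite /cut_gap.
  by move: (L * ab.1) (L * ab.2) => A B; lia.
case: ifP => // _; suff : (cut_dist Z e).-1 <= cut_dist Z' e by lia.
apply/leq_cut_dist; split; first by lia.
move=> j ab jn abE; have := dist _ _ jn abE; have := ZZ' j; rewrite /cut_gap.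
by move: (L * ab.1) (L * ab.2) => A B; lia.
Qed.

(** An uncut interval through [q] lies in the segment of [q], so a common point would give a common
    segment. *)
Lemma cut_segs_disjoint Z e f ab cd q :
  0 < cut_dist Z e -> 0 < cut_dist Z f -> [disjoint cut_segs Z e & cut_segs Z f] ->
  ab \in E e -> cd \in E f -> ab.1 <= q <= ab.2 -> ~~ (cd.1 <= q <= cd.2).
Proof.
move=> /leq_cut_dist[_ de] /leq_cut_dist[_ df] dis abE cdE qab; apply/negP => qcd.
have key xy (g : 'I_m) : xy \in E g -> xy.1 <= q <= xy.2 ->
    (forall j ab, j < n -> ab \in E g -> 0 < cut_gap (Z j) ab) ->
    cut_seg Z xy.1 = cut_seg Z q.
  move=> xyE qxy dg; apply: eq_in_count => j; rewrite mem_iota => /andP[_ jn].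
  have : L * xy.1 <= L * q <= L * xy.2 
    by rewrite !leq_mul2l; case/andP: qxy => -> ->; rewrite !orbT.
  have := dg _ _ jn xyE; rewrite /cut_gap.
  by move: (L * xy.1) (L * q) (L * xy.2) => A Q' B; lia.
move: dis; rewrite disjoint_subset => /subsetP/(_ (Ordinal (cut_seg_le Z q))).
case/(_ _)/negP; first by apply/cut_segsP; exists ab => //; apply: key de.
by apply/cut_segsP; exists cd => //; apply: key df.
Qed.

(** [P] is the load of segment 0 at a Sperner vertex [Z] labelled 0. Passing to the vertex [Z']
    labelled [i] and back costs [2 * m] each way, and at [Z'] segment [i] is at least as heavy as
    segment 0. *)
Lemma balanced_cut : exists (S : 'I_m -> {set 'I_n.+1}) (phi : 'I_m -> nat) (P : nat),
  [/\ forall e, #|S e| <= size (E e),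
      forall e f ab cd q, 0 < phi e -> 0 < phi f -> [disjoint S e & S f] ->
        ab \in E e -> cd \in E f -> ab.1 <= q <= ab.2 -> ~~ (cd.1 <= q <= cd.2),
      forall i, \sum_(e | i \in S e) phi e <= P <= \sum_(e | i \in S e) phi e + 4 * m &
      G <= P].
Proof.
have M0 : 0 < M by apply: leq_trans G_gt0 G_le_M.
have [Y HY] := sperner M0 cut_lab_segment.
have [Z [_ _ ZY Z0]] := HY 0 isT.
exists (cut_segs Z), (cut_dist Z), (cut_load Z ord0).
have le0 i : cut_load Z i <= cut_load Z ord0.
  have [l El il] := cut_labP Z i; suff <- : l = ord0 by [].
  by apply: val_inj; rewrite /= -El.
split.
- by move=> e; rewrite cardsE (leq_trans (card_size _)) // size_map.
- exact: cut_segs_disjoint.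
- move=> i; rewrite le0 /=; have [Z' [_ _ Z'Y Z'i]] := HY i (ltn_ord i).
  have ZZ' j : Z j <= (Z' j).+1 /\ Z' j <= (Z j).+1.
    by have := ZY j; have := Z'Y j; lia.
  have L1 := cut_load_lipschitz ord0 ZZ'.
  have L2 := @cut_load_lipschitz Z' Z i (fun j => conj (ZZ' j).2 (ZZ' j).1).
  have [l El il] := cut_labP Z' ord0.
  have li : l = i by apply: val_inj; rewrite /= -El.
  by rewrite li in il; rewrite -/(cut_load Z i); lia.
- by have [i Gi] := cut_load_far Z; apply: leq_trans Gi (le0 i).
Qed.

End BalancedCut.

(** * Matchings in graphs with nearly equal vertex weights *)

Lemma leq_card_bigcup (I T : finType) (A : {pred I}) (F : I -> {set T}) :
  #|\bigcup_(i in A) F i| <= \sum_(i in A) #|F i|.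
Proof.
elim/big_rec2: _ => [|i s t _ le]; first by rewrite cards0.
by apply: leq_trans (leq_add (leqnn _) le); rewrite leq_card_setU.
Qed.

Section BalancedMatching.

Variables (I V : finType) (S : I -> {set V}) (phi : I -> nat) (P D : nat).

Definition matching (Mt : {set I}) : bool :=
  [forall e in Mt, 0 < phi e] &&
  [forall e in Mt, forall f in Mt, (e != f) ==> [disjoint S e & S f]].

Lemma matchingP (Mt : {set I}) : reflect
  ((forall e, e \in Mt -> 0 < phi e) /\
   (forall e f v, e \in Mt -> f \in Mt -> v \in S e -> v \in S f -> e = f))
  (matching Mt).
Proof.
apply: (iffP andP) => -[pos dis]; split.
- by move=> e eM; move/forall_inP: pos; apply.
- move=> e f v eM fM ve vf; apply/eqP; apply/negPn/negP => ef.
  move/forall_inP: dis => /(_ e eM)/forall_inP/(_ f fM); rewrite ef /=.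
  by move/disjoint_setI0/setP/(_ v); rewrite !inE ve vf.
- exact/forall_inP.
- apply/forall_inP => e eM; apply/forall_inP => f fM; apply/implyP => ef.
  apply/pred0P => v /=; apply/negbTE/andP => -[ve vf].
  by move/eqP: ef; apply; apply: dis ve vf.
Qed.

Hypothesis load_bound : forall i,
  \sum_(e | i \in S e) phi e <= P <= \sum_(e | i \in S e) phi e + D.
Hypothesis load_large : D * #|V| < P.

(** Every vertex has positive load, hence an edge of positive weight through it; such loops at
    distinct vertices are disjoint. *)
Lemma loops_matching : (forall e, #|S e| <= 1) ->
  exists2 Mt, matching Mt & #|V| <= #|Mt|.
Proof.
move=> S1; have ex v : exists e, (v \in S e) && (0 < phi e).
  apply/existsP; move: (load_bound v) => /andP[_]; apply: contraLR.
  rewrite negb_exists => /forallP H; rewrite big1 ?add0n -?ltnNge.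
    by apply: leq_ltn_trans load_large; rewrite leq_pmulr //; apply/card_gt0P; exists v.
  by move=> e ve; move: (H e); rewrite ve /=; lia.
have [g gP] := fin_all_exists ex; exists (g @: setT).
  apply/matchingP; split=> [_ /imsetP[v _ ->]|_ _ w /imsetP[v _ ->] /imsetP[u _ ->] wv wu].
    by case/andP: (gP v).
  have /andP[vg _] := gP v; have /andP[ug _] := gP u.
  congr g; transitivity w; first exact: (card_le1_eqP (S1 (g v))).
  exact: (card_le1_eqP (S1 (g u))).
rewrite card_in_imset ?cardsT // => v u _ _ E.
have /andP[vg _] := gP v; have /andP[ug _] := gP u.
by apply: (card_le1_eqP (S1 (g v))) => //; rewrite E.
Qed.

(* In a maximum matching Mt, no edge of Mt has two distinct endpoints with distinct uncovered
   neighbours. So an edge of Mt either has a single uncovered neighbour (M2), or it is attached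
   to the uncovered vertices through a single endpoint (M1), whose weight bounds theirs. *)
Lemma edges_matching : (forall e, #|S e| <= 2) ->
  exists2 Mt, matching Mt & #|V| <= 3 * #|Mt|.
Proof.
move=> S2; have m0 : matching set0.
  by apply/matchingP; split=> [e|e f v]; rewrite inE.
have [Mt mM Mmax] := arg_maxnP (fun Mt : {set I} => #|Mt|) m0; exists Mt => //.
have {m0} [pos dis] := matchingP _ mM.
pose cov := \bigcup_(e in Mt) S e; pose U := ~: cov.
have covP e v : e \in Mt -> v \in S e -> v \in cov by move=> eM ve; apply/bigcupP; exists e.
have notM f u : u \in U -> u \in S f -> f \notin Mt.
  by move=> uU uf; apply: contraTN uU => fM; rewrite inE negbK (covP f).
(* The other end of [f] must be covered, for otherwise [f] could be added to [Mt]. *)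
have attach f u : 0 < phi f -> u \in U -> u \in S f ->
    exists e a, [/\ e \in Mt, a \in S e & S f = [set u; a]].
  move=> pf uU uf; have fM := notM f u uU uf.
  have [a af ac] : exists2 a, a \in S f & a \in cov.
    apply/exists_inP; apply: contraT; rewrite negb_exists_in => /forall_inP H.
    suff /Mmax : matching (f |: Mt) by rewrite cardsU1 fM /=; lia.
    apply/matchingP; split=> [e|e g v]; rewrite !inE.
      by move=> /orP[/eqP->|/pos].
    move=> /orP[/eqP->|eM] /orP[/eqP->|gM] // ve vg.
    - by have := H _ ve; rewrite (covP g).
    - by have := H _ vg; rewrite (covP e).
    - exact: dis ve vg.
  have /bigcupP[e eM ae] := ac; exists e, a; split=> //.
  apply/esym/eqP; rewrite eqEcard subUset !sub1set uf af cards2 /=.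
  have -> : u != a by apply: contraTneq uU => ->; rewrite inE ac.
  exact: S2.
(* If [a] and [b] differed, replacing [e] by [f] and [f'] would enlarge [Mt]. *)
have swap e f f' u u' a b : e \in Mt -> 0 < phi f -> 0 < phi f' -> u \in U -> u' \in U ->
    u \in S f -> a \in S f -> u' \in S f' -> b \in S f' -> a \in S e -> b \in S e ->
    u != u' -> a = b.
  move=> eM pf pf' uU uU' uf af uf' bf' ae be uu'; apply/eqP; apply: contraT => ab.
  have two g w c : 0 < phi g -> w \in U -> w \in S g -> c \in S g -> c \in S e ->
      S g = [set w; c].
    move=> pg wU wg cg ce; have [e' [a' [eM' ae' Eg]]] := attach g w pg wU wg.
    move: cg; rewrite Eg !inE => /orP[/eqP cw|/eqP->//].
    by move: wU; rewrite -cw inE (covP e).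
  have Ef := two f u a pf uU uf af ae; have Ef' := two f' u' b pf' uU' uf' bf' be.
  have neU c w : c \in S e -> w \in U -> c != w.
    by move=> ce wU; apply: contraTneq wU => <-; rewrite inE negbK (covP e).
  have fM := notM f u uU uf; have fM' := notM f' u' uU' uf'.
  have meet g w c h v : S g = [set w; c] -> w \in U -> c \in S e -> h \in Mt -> h != e ->
      v \in S g -> v \in S h -> False.
    move=> -> wU ce hM /eqP he; rewrite !inE => /orP[/eqP->|/eqP->] vh.
      by move: wU; rewrite inE (covP h).
    by apply: he; apply: dis vh ce.
  have ff' v : v \in S f -> v \in S f' -> False.
    rewrite Ef Ef' !inE => /orP[]/eqP-> /orP[].
    - by rewrite (negbTE uu').
    - by rewrite eq_sym (negbTE (neU _ _ be uU)).
    - by rewrite (negbTE (neU _ _ ae uU')).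
    - by rewrite (negbTE ab).
  suff /Mmax : matching (f |: (f' |: (Mt :\ e))).
    rewrite !cardsU1 !inE (negbTE fM) (negbTE fM') !andbF /= orbF.
    have -> : f != f' by apply/eqP => E; apply: (ff' u); rewrite // -E.
    by rewrite (cardsD1 e Mt) eM !add1n ltnn.
  apply/matchingP; split=> [g|g h v]; rewrite !inE.
    by move=> /or3P[/eqP->|/eqP->|/andP[_ /pos]].
  move=> /or3P[/eqP->|/eqP->|/andP[ge gM]] /or3P[/eqP->|/eqP->|/andP[he hM]] // vg vh.
  - by case: (ff' v).
  - by case: (meet f u a h v).
  - by case: (ff' v).
  - by case: (meet f' u' b h v).
  - by case: (meet f u a g v).
  - by case: (meet f' u' b g v).
  - exact: dis vg vh.
pose nb e := [set u in U | [exists f, [&& 0 < phi f, u \in S f & ~~ [disjoint S f & S e]]]].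
pose A e := [set a in S e | [exists f, [&& 0 < phi f, a \in S f & ~~ [disjoint S f & U]]]].
have meetP (B C : {set V}) : reflect (exists2 v, v \in B & v \in C) (~~ [disjoint B & C]).
  apply: (iffP pred0Pn) => [[v /andP[]]|[v vB vC]]; first by exists v.
  by exists v; rewrite /= vB.
pose M2 := [set e in Mt | #|nb e| == 1]; pose M1 := Mt :\: M2.
pose T := [set u in U | [exists e in M2, u \in nb e]]; pose U' := U :\: T.
have cT : #|T| <= #|M2|.
  apply: (@leq_trans #|\bigcup_(e in M2) nb e|).
    apply/subset_leq_card/subsetP => u; rewrite inE => /andP[_ /exists_inP[e eM2 ue]].
    by apply/bigcupP; exists e.
  apply: leq_trans (leq_card_bigcup _ _) _; rewrite -sum1_card; apply: leq_sum => e.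
  by rewrite inE => /andP[_ /eqP->].
have A1 e : e \in M1 -> #|A e| <= 1.
  rewrite !inE => /andP[+ eM]; rewrite eM /= => nb1.
  apply/card_le1_eqP => a b; rewrite !inE.
  move=> /andP[ae /existsP[f1 /and3P[p1 af1 /meetP[u1 uf1 uU1]]]].
  move=> /andP[be /existsP[f2 /and3P[p2 bf2 /meetP[u2 uf2 uU2]]]].
  have [u12|u12] := eqVneq u1 u2; last exact/esym/(swap e f1 f2 u1 u2).
  have unb : u1 \in nb e.
    by rewrite inE uU1; apply/existsP; exists f1; rewrite p1 uf1; apply/meetP; exists a.
  (* A second uncovered neighbour [u3], attached through [c], gives [a = c = b] by two uses of
     [swap]. *)
  have [u3] : exists2 u3, u3 \in nb e & u3 != u1.
    apply/exists_inP; apply: contraR nb1; rewrite negb_exists_in => /forall_inP H.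
    rewrite (_ : nb e = [set u1]) ?cards1 //; apply/setP => x; rewrite in_set1.
    by apply/idP/eqP => [/H|->//]; rewrite negbK => /eqP.
  rewrite inE => /andP[uU3 /existsP[f3 /and3P[p3 uf3 /meetP[c cf3 ce]]]] u31.
  rewrite -(swap e f3 f1 u3 u1 c a) // -(swap e f3 f2 u3 u2 c b) //; by rewrite -u12.
(* Double counting by edges [f] of positive weight: one with an end in [U'] has no other end there,
   and it has an end in [A e] for some [e] in [M1]. *)
have key : \sum_(u in U') \sum_(f | u \in S f) phi f <=
           \sum_(e in M1) \sum_(a in A e) \sum_(f | a \in S f) phi f.
  have dbl (B : {set V}) : \sum_(u in B) \sum_(f | u \in S f) phi f =
      \sum_f phi f * #|S f :&: B|.
    rewrite (exchange_big_dep xpredT) //=; apply: eq_bigr => f _.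
    rewrite sum_nat_const mulnC; congr (_ * _).
    by apply: eq_card => v; rewrite !inE andbC.
  rewrite dbl; under [X in _ <= X]eq_bigr do rewrite dbl.
  rewrite exchange_big /=; apply: leq_sum => f _; rewrite -big_distrr /=.
  have [->|pf0] := eqVneq (phi f) 0; first by rewrite mul0n.
  have pf : 0 < phi f by rewrite lt0n.
  rewrite leq_mul2l (negbTE pf0) /=.
  have [->|[u]] := set_0Vmem (S f :&: U'); first by rewrite cards0.
  rewrite inE => /andP[uf]; rewrite in_setD => /andP[uT uU].
  have [e [a [eM ae Ef]]] := attach f u pf uU uf.
  have af : a \in S f by rewrite Ef !inE eqxx orbT.
  have aU : a \notin U by rewrite inE negbK (covP e).
  have eM1 : e \in M1.
    rewrite in_setD eM andbT; apply: contra uT => eM2; rewrite inE uU /=.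
    apply/exists_inP; exists e => //; rewrite inE uU; apply/existsP; exists f.
    by rewrite pf uf; apply/meetP; exists a.
  rewrite (bigD1 e) //=; apply: leq_trans (leq_addr _ _).
  apply: (@leq_trans #|[set u]|).
    apply/subset_leq_card/subsetP => v; rewrite Ef !inE => /andP[/orP[//|/eqP->]].
    by move: aU; rewrite inE negbK => ->; rewrite andbF.
  rewrite cards1; apply/card_gt0P; exists a; rewrite !inE af ae /=.
  by apply/existsP; exists f; rewrite pf af; apply/meetP; exists u.
(* The loads give [#|U'| * P <= #|M1| * P + #|U'| * D], where the last term is less than [P]. *)
have cU : #|U'| <= #|M1|.
  have up : \sum_(e in M1) \sum_(a in A e) \sum_(f | a \in S f) phi f <= #|M1| * P.
    rewrite -sum_nat_const; apply: leq_sum => e /A1 Ae.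
    apply: (@leq_trans (#|A e| * P)); last by rewrite -[leqRHS]mul1n leq_mul2r Ae orbT.
    by rewrite -sum_nat_const; apply: leq_sum => a _; case/andP: (load_bound a).
  have low : #|U'| * P <= \sum_(u in U') \sum_(f | u \in S f) phi f + #|U'| * D.
    rewrite -!sum_nat_const -big_split /=; apply: leq_sum => u _.
    by case/andP: (load_bound u).
  have UV : #|U'| <= #|V| by apply: max_card.
  rewrite -ltnS -(ltn_pmul2r (m := P)); last by apply: leq_ltn_trans load_large.
  rewrite mulSn; have : #|U'| * D <= D * #|V| by rewrite mulnC leq_mul2l UV orbT.
  by lia.
have cC : #|cov| <= 2 * #|Mt|.
  apply: leq_trans (leq_card_bigcup _ _) _; rewrite mulnC -sum_nat_const.
  by apply: leq_sum => e _; apply: S2.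
have cMt : #|M2| + #|M1| = #|Mt|.
  rewrite -(cardsID M2 Mt); congr (_ + _); apply: eq_card => e; rewrite !inE.
  by case: (e \in Mt).
have cUt : #|U| <= #|T| + #|U'|.
  by rewrite -(cardsID T U) leq_add2r subset_leq_card // subsetIr.
have := cardsC cov; rewrite -/U; lia.
Qed.

End BalancedMatching.

End BalancedCuts.

Module DIntervals.
Import all_boot all_order all_algebra zify.zify.
Import algebra_tactics.ring algebra_tactics.lra boolp Rstruct.
Import Order.TTheory GRing.Theory Num.Theory.
Import Sperner BalancedCuts.
Set Implicit Arguments.
Unset Strict Implicit.
Unset Printing Implicit Defensive.
Local Open Scope ring_scope.

(** * Farkas' lemma and the weighted Turan inequality *)

Section Farkas.

Variables (R : realFieldType) (I : finType).
Local Notation V := {ffun I -> R^o}.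

Definition dot (a x : V) : R := \sum_i a i * x i.

Lemma dotBl a b x : dot (a - b) x = dot a x - dot b x.
Proof. by rewrite /dot -sumrB; apply: eq_bigr => i _; rewrite !ffunE mulrBl. Qed.

Lemma dotZl c a x : dot (c *: a) x = c * dot a x.
Proof. by rewrite /dot mulr_sumr; apply: eq_bigr => i _; rewrite !ffunE mulrA. Qed.

Lemma dotBr a x y : dot a (x - y) = dot a x - dot a y.
Proof. by rewrite /dot -sumrB; apply: eq_bigr => i _; rewrite !ffunE mulrBr. Qed.

Lemma dotZr c a x : dot a (c *: x) = c * dot a x.
Proof. by rewrite /dot mulr_sumr; apply: eq_bigr => i _; rewrite !ffunE mulrCA. Qed.

Fixpoint cone (s : seq V) (b : V) : Prop :=
  if s is a :: s' then exists2 c, 0 <= c & cone s' (b - c *: a) else b = 0.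

(** Replacing each projected generator by [a] changes the combination by a multiple of [h], whose
    sign is controlled by [dot a x <= 0]. *)
Lemma cone_project (h x : V) (s : seq V) (b : V) :
  (forall a, a \in s -> dot a x <= 0) ->
  cone [seq a - dot a x *: h | a <- s] b ->
  exists2 c, 0 <= c & cone s (b - c *: h).
Proof.
elim: s b => [|a s IHs] b ax /=; first by move=> ->; exists 0; rewrite // scale0r subr0.
case=> l l0 /IHs[|c c0 cs]; first by move=> y ys; apply: ax; rewrite inE ys orbT.
have ax0 : dot a x <= 0 by apply: ax; rewrite mem_head.
exists (c - l * dot a x); first by nra.
exists l => //; congr cone: cs; rewrite scalerBr scalerA scalerBl.
by apply/ffunP => i; rewrite !ffunE; ring.
Qed.

(* Bartl's induction: if b is not nonpositive on the cone dual to s alone, a witness x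
   normalised by [dot h x = 1] projects everything onto the kernel of h along x. *)
Lemma farkas (s : seq V) (b : V) :
  (forall x, (forall a, a \in s -> dot a x <= 0) -> dot b x <= 0) -> cone s b.
Proof.
have [m] := ubnP (size s); elim: m s b => // m IHm [|h s] b /=; rewrite ?ltnS => szm Hb.
  have : dot b b <= 0 by apply: Hb.
  rewrite /dot => le; apply/ffunP => i; rewrite ffunE; apply/eqP.
  rewrite -sqrf_eq0 expr2; have pos j : true -> 0 <= b j * b j by rewrite -expr2 sqr_ge0.
  have : \sum_i b i * b i == 0 by rewrite eq_le le sumr_ge0.
  by rewrite psumr_eq0 // => /allP/(_ i); rewrite mem_index_enum; apply.
have [Hs|/existsNP[x /not_implyP[xs /negP]]] :=
    pselect (forall x, (forall a, a \in s -> dot a x <= 0) -> dot b x <= 0).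
  by exists 0 => //; rewrite scale0r subr0; apply: IHm.
rewrite -ltNge => bx; have hx : 0 < dot h x.
  rewrite ltNge; apply: contraTN bx => hx; rewrite -leNgt; apply: Hb => a.
  by rewrite inE => /orP[/eqP->|/xs].
pose y := (dot h x)^-1 *: x.
have ys a : a \in s -> dot a y <= 0.
  by move=> /xs ax; rewrite dotZr mulr_ge0_le0 // invr_ge0 ltW.
have hy : dot h y = 1 by rewrite dotZr mulVf // gt_eqF.
have by0 : 0 < dot b y by rewrite dotZr mulr_gt0 // invr_gt0.
clearbody y; have [|c c0 cs] := @cone_project h y s (b - dot b y *: h) ys.
  apply: IHm => [|z zs]; first by rewrite size_map.
  (* Projecting generators is adjoint to sending [z] to [z - dot h z *: y], which is orthogonal to
     [h]. *)
  have proj a : dot (a - dot a y *: h) z = dot a (z - dot h z *: y).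
    by rewrite dotBl dotZl dotBr dotZr mulrC.
  rewrite proj; apply: Hb => a; rewrite inE => /orP[/eqP->|az].
    by rewrite dotBr dotZr hy mulr1 subrr.
  by rewrite -proj; apply: zs; apply: map_f.
by exists (dot b y + c); [lra | rewrite scalerDl opprD addrA].
Qed.

Lemma cone_cat s1 s2 b : cone (s1 ++ s2) b ->
  exists2 c, cone s1 (b - c) & cone s2 c.
Proof.
elim: s1 b => [|a s IHs] b /=; first by exists b => //; rewrite subrr.
by case=> l l0 /IHs[c c1 c2]; exists c => //; exists l => //; rewrite addrAC.
Qed.

Lemma cone_coord_ge0 (s : seq V) b i : (forall a, a \in s -> 0 <= a i) -> cone s b -> 0 <= b i.
Proof.
elim: s b => [|a s IHs] b ai /=; first by move=> ->; rewrite ffunE.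
case=> l l0 /IHs; have := ai a (mem_head _ _); rewrite !ffunE /= => a0 H.
have {H} : 0 <= b i - l * a i by apply: H => y ys; apply: ai; rewrite inE ys orbT.
by nra.
Qed.

Lemma cone_coord_le0 (s : seq V) b i : (forall a, a \in s -> a i <= 0) -> cone s b -> b i <= 0.
Proof.
elim: s b => [|a s IHs] b ai /=; first by move=> ->; rewrite ffunE.
case=> l l0 /IHs; have := ai a (mem_head _ _); rewrite !ffunE /= => a0 H.
have {H} : b i - l * a i <= 0 by apply: H => y ys; apply: ai; rewrite inE ys orbT.
by nra.
Qed.

Lemma cone_map (X : Type) (F : X -> V) (s : seq X) b : cone [seq F x | x <- s] b ->
  exists g : seq (X * R), all (fun p => 0 <= p.2) g /\
    forall i, b i = \sum_(p <- g) p.2 * F p.1 i.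
Proof.
elim: s b => [|x s IHs] b /=.
  by move=> ->; exists [::]; split=> // i; rewrite big_nil ffunE.
case=> l l0 /IHs[g [g0 gE]]; exists ((x, l) :: g); split=> [|i] /=; first by rewrite l0.
by rewrite big_cons -gE !ffunE /= addrC subrK.
Qed.

End Farkas.

(** Farkas' lemma for the target [(T, 1, ..., 1)]: coordinate 0 records the total weight, the others
    the weight on each edge, and [vec 1 (fun=> 0)] and [sl f] absorb slack. A separating vector has
    entries [- z] and [w f]. *)
Lemma cover_or_packing (R : realFieldType) (m : nat) (X : eqType) (pts : seq X)
    (inc : X -> 'I_m -> bool) (T : R) :
  (exists g : seq (X * R), [/\ all (fun p => 0 <= p.2) g,
     forall f, 1 <= \sum_(p <- g) (if inc p.1 f then p.2 else 0) &
     \sum_(p <- g) p.2 <= T]) \/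
  (exists (w : 'I_m -> R) (z : R), [/\ forall f, 0 <= w f, 0 <= z,
     forall p, p \in pts -> \sum_(f | inc p f) w f <= z & T * z < \sum_f w f]).
Proof.
pose vec (a0 : R) (a : 'I_m -> R) : {ffun 'I_m.+1 -> R^o} :=
  [ffun i => oapp a a0 (unlift ord0 i)].
have vec0 a0 a : vec a0 a ord0 = a0 by rewrite ffunE unlift_none.
have vecS a0 a i : vec a0 a (lift ord0 i) = a i by rewrite ffunE liftK.
have dotv a0 a x : dot (vec a0 a) x = a0 * x ord0 + \sum_i a i * x (lift ord0 i).
  by rewrite /dot big_ord_recl vec0; under eq_bigr do rewrite vecS.
pose F p := vec 1 (fun f => (inc p f)%:R).
pose sl f := vec 0 (fun f' => - (f == f')%:R).
pose s := [seq F p | p <- pts] ++ (vec 1 (fun=> 0) :: [seq sl f | f <- enum 'I_m]).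
have [Hs|/existsNP[x /not_implyP[xs /negP]]] :=
    pselect (forall x, (forall a, a \in s -> dot a x <= 0) -> dot (vec T (fun=> 1)) x <= 0).
  left; have [c /cone_map[g [g0 gE]] cs] := cone_cat (farkas Hs); exists g; split=> //.
    move=> f; have : c (lift ord0 f) <= 0.
      apply: cone_coord_le0 cs => a; rewrite inE => /orP[/eqP->|/mapP[f' _ ->]].
        by rewrite vecS.
      by rewrite vecS oppr_le0 ler0n.
    have := gE (lift ord0 f); rewrite !ffunE /= liftK /= => E c0.
    rewrite (eq_bigr (fun p => p.2 * F p.1 (lift ord0 f))).
      by rewrite -E; lra.
    by move=> p _; rewrite vecS; case: ifP; rewrite (mulr1, mulr0).
  have : 0 <= c ord0.
    apply: cone_coord_ge0 cs => a; rewrite inE => /orP[/eqP->|/mapP[f' _ ->]].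
      by rewrite vec0.
    by rewrite vec0.
  have := gE ord0; rewrite !ffunE /= unlift_none /= => E c0.
  rewrite (eq_bigr (fun p => p.2 * F p.1 ord0)); first by rewrite -E; lra.
  by move=> p _; rewrite vec0 mulr1.
rewrite -ltNge dotv => bx; right; exists (fun f => x (lift ord0 f)), (- x ord0); split.
- move=> f; have : dot (sl f) x <= 0.
    by apply: xs; rewrite mem_cat inE map_f ?mem_enum // !orbT.
  rewrite dotv mul0r add0r (bigD1 f) //= eqxx big1 ?addr0 ?mulN1r ?oppr_le0 //.
  by move=> f'; rewrite eq_sym => /negbTE->; rewrite oppr0 mul0r.
- have : dot (vec 1 (fun=> 0)) x <= 0 by apply: xs; rewrite mem_cat inE eqxx orbT.
  by rewrite dotv mul1r big1 ?addr0 ?oppr_ge0 // => i _; rewrite mul0r.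
- move=> p pp; have : dot (F p) x <= 0 by apply: xs; rewrite mem_cat map_f.
  rewrite dotv mul1r (big_mkcond (inc p)) /=.
  rewrite (eq_bigr (fun f => if inc p f then x (lift ord0 f) else 0)); first by lra.
  by move=> f _; case: ifP; rewrite (mul1r, mul0r).
- by move: bx; under eq_bigr do rewrite mul1r; rewrite mulrN; lra.
Qed.

Section Turan.

Variables (R : realFieldType) (I : finType) (adj : rel I) (w : I -> R).
Hypothesis adj_refl : reflexive adj.
Hypothesis adj_sym : symmetric adj.
Hypothesis w_ge0 : forall i, 0 <= w i.

Definition independent (A : {set I}) : Prop :=
  forall i j, i \in A -> j \in A -> adj i j -> i = j.

(* Greedy: delete the closed neighbourhood of a vertex of minimum weighted degree. *)
Lemma weighted_turan (a : nat) (B : {set I}) :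
  (forall A : {set I}, A \subset B -> independent A -> (#|A| <= a)%N) ->
  (\sum_(i in B) w i) ^+ 2 <=
  a%:R * \sum_(i in B) w i * \sum_(j in B | adj i j) w j.
Proof.
have Q0 (C : {set I}) : 0 <= \sum_(i in C) w i * \sum_(j in C | adj i j) w j.
  by apply: sumr_ge0 => i _; rewrite mulr_ge0 // sumr_ge0.
elim: a B => [|a IHa] B HB; have [->|[v0 Bv0]] := set_0Vmem B.
- by rewrite !big_set0 expr0n mul0r.
- have : (#|[set v0]| <= 0)%N.
    by apply: HB; rewrite ?sub1set // => i j; rewrite !inE => /eqP-> /eqP->.
  by rewrite cards1.
- by rewrite !big_set0 expr0n mulr0.
case: (@arg_minP _ _ _ v0 (mem B) (fun i => \sum_(j in B | adj i j) w j) Bv0) => v vB vmin.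
have Bv : v \in B by exact: vB.
pose C := [set i in B | ~~ adj v i].
have IH := IHa C.
have {IH} : (\sum_(i in C) w i) ^+ 2 <=
  a%:R * \sum_(i in C) w i * \sum_(j in C | adj i j) w j.
  apply: IH => A AC indA; have vA : v \notin A.
    by apply/negP => /(subsetP AC); rewrite inE adj_refl andbF.
  have : (#|v |: A| <= a.+1)%N.
    apply: HB.
      rewrite subUset sub1set Bv (subset_trans AC) //.
      by apply/subsetP => i; rewrite inE => /andP[].
    move=> i j; rewrite !inE => /orP[/eqP->|iA] /orP[/eqP->|jA] //.
    - by move: (subsetP AC _ jA); rewrite inE => /andP[_ /negbTE->].
    - by rewrite adj_sym; move: (subsetP AC _ iA); rewrite inE => /andP[_ /negbTE->].
    - exact: indA.
  by rewrite cardsU1 vA.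
set S' := \sum_(i in C) w i; set Q' := \sum_(i in C) _ => IH.
set mu := \sum_(j in B | adj v j) w j.
have S'0 : 0 <= S' by apply: sumr_ge0.
have mu0 : 0 <= mu by apply: sumr_ge0.
have -> : \sum_(i in B) w i = mu + S'.
  rewrite (bigID (adj v)) /=; congr (_ + _); apply: eq_bigl => i.
  by rewrite !inE.
(* Neighbours of [v] have weighted degree at least [mu] by the choice of [v]; the other vertices
   have at least their degree within [C]. *)
have : mu * mu + Q' <= \sum_(i in B) w i * \sum_(j in B | adj i j) w j.
  rewrite [leRHS](bigID (adj v)) /=; apply: lerD.
    rewrite mulr_suml; apply: ler_sum => i /andP[iB _].
    by apply: ler_wpM2l => //; apply: vmin.
  rewrite /Q' [leRHS](eq_bigl (mem C)); last by move=> i; rewrite !inE.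
  apply: ler_sum => i iC; apply: ler_wpM2l => //.
  rewrite [leRHS](bigID (mem C)) /= [leLHS](eq_bigl (fun j => (j \in B) && adj i j && (j \in C))).
    by rewrite lerDl sumr_ge0.
  by move=> j; rewrite !inE; case: (j \in B); case: (adj i j); case: (adj v j).
have Q'0 : 0 <= Q' by exact: Q0.
move: IH; rewrite -natr1; have : 0 <= a%:R :> R by rewrite ler0n.
move: (a%:R : R) (\sum_(i in B) _) => q Q q0 IH le.
have q1 : 0 <= q + 1 by rewrite addr_ge0.
apply: le_trans (ler_wpM2l q1 le).
have [q00|qn0] := eqVneq q 0.
  have : S' ^+ 2 <= 0 by rewrite q00 mul0r in IH.
  rewrite q00 => s0; have S'2 : S' = 0 by apply/eqP; rewrite -sqrf_eq0 eq_le s0 sqr_ge0.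
  by rewrite S'2 addr0 add0r mul1r expr2 lerDl.
have qp : 0 < q by rewrite lt_def qn0.
(* After multiplication by [q], the difference is a square plus a multiple of the slack in the
   induction hypothesis. *)
rewrite -(ler_pM2l qp) -subr_ge0.
have -> : q * ((q + 1) * (mu * mu + Q')) - q * (mu + S') ^+ 2 =
    (q * mu - S') ^+ 2 + (q + 1) * (q * Q' - S' ^+ 2) by ring.
by rewrite addr_ge0 ?sqr_ge0 // mulr_ge0 ?subr_ge0 // addr_ge0.
Qed.

End Turan.

Lemma cover_of_turan (R : realFieldType) (m d n : nat) (X : eqType)
    (L : 'I_m -> seq X) (inc : X -> 'I_m -> bool) (adj : rel 'I_m) :
  (forall i, size (L i) <= d)%N -> reflexive adj -> symmetric adj ->
  (forall i j, adj i j -> has (inc^~ j) (L i) || has (inc^~ i) (L j)) ->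
  (forall A : {set 'I_m}, independent adj A -> (#|A| <= n)%N) ->
  exists g : seq (X * R), [/\ all (fun p => 0 <= p.2) g,
     forall f, 1 <= \sum_(p <- g) (if inc p.1 f then p.2 else 0) &
     \sum_(p <- g) p.2 <= (2 * d * n)%:R].
Proof.
move=> Ld arefl asym adjL An.
have [//|[w [z [w0 z0 wz]]]] :=
  cover_or_packing (flatten [seq L i | i <- enum 'I_m]) inc ((2 * d * n)%:R : R).
set S := \sum_f w f => big.
have S0 : 0 < S by apply: le_lt_trans big; rewrite mulr_ge0 // ler0n.
have := @weighted_turan R _ adj w arefl asym w0 n setT (fun A _ => An A).
have -> : \sum_(i in setT) w i = S by apply: eq_bigl => i; rewrite inE.
have -> : \sum_(i in setT) w i * \sum_(j in setT | adj i j) w j =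
    \sum_i w i * \sum_(j | adj i j) w j.
  apply: eq_big => [i|i _]; rewrite ?inE //; congr (_ * _).
  by apply: eq_bigl => j; rewrite inE.
move=> turan.
(* [c i j] counts the points of [L i] in edge [j]; for an adjacent pair [c i j] or [c j i] is at
   least 1. *)
pose c i j : R := (count (inc^~ j) (L i))%:R.
have csum i : \sum_j w j * c i j <= d%:R * z.
  have -> : \sum_j w j * c i j = \sum_(p <- L i) \sum_(f | inc p f) w f.
    rewrite (exchange_big_dep xpredT) //=; apply: eq_bigr => j _.
    by rewrite big_const_seq iter_addr_0 /c mulr_natr.
  apply: (@le_trans _ _ (\sum_(p <- L i) z)).
    rewrite big_seq [leRHS]big_seq; apply: ler_sum => p pL; apply: wz.
    by apply/flattenP; exists (L i) => //; apply: map_f; rewrite mem_enum.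
  rewrite big_const_seq iter_addr_0 count_predT -[_ *+ _]mulr_natl.
  by apply: ler_wpM2r => //; rewrite ler_nat.
have : \sum_i w i * \sum_(j | adj i j) w j <= 2 * (d%:R * z) * S.
  apply: (@le_trans _ _ (\sum_i (w i * \sum_j w j * c i j + \sum_j w i * w j * c j i))).
    apply: ler_sum => i _; rewrite !mulr_sumr -big_split /= big_mkcond /=.
    apply: ler_sum => j _.
    have ww : 0 <= w i * w j by rewrite mulr_ge0.
    have c0 : 0 <= c i j by rewrite ler0n.
    have c0' : 0 <= c j i by rewrite ler0n.
    case: ifP => [/adjL|_]; last by rewrite mulrA addr_ge0 ?mulr_ge0.
    rewrite !has_count => /orP[h|h].
      have : 1 <= c i j by rewrite ler1n.
      by nra.
    have : 1 <= c j i by rewrite ler1n.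
    by nra.
  rewrite big_split /= [X in _ + X]exchange_big /=.
  under [X in _ + X]eq_bigr => j _ do under eq_bigr => i _ do rewrite [w i * w j]mulrC -mulrA.
  under [X in _ + X]eq_bigr => j _ do rewrite -mulr_sumr.
  rewrite -mulr2n -[leLHS]mulr_natl -[leRHS]mulrA; apply: ler_wpM2l => //.
  rewrite /S mulr_sumr; apply: ler_sum => i _.
  by rewrite mulrC; apply: ler_wpM2r.
move: turan big; rewrite !natrM; have : 0 <= n%:R :> R by rewrite ler0n.
move: (\sum_i w i * _) (n%:R : R) (d%:R : R) => Q N D N0 turan big le.
have : S ^+ 2 <= N * (2 * (D * z) * S) by apply: le_trans turan (ler_wpM2l _ le).
rewrite expr2 mulrA ler_pM2r // => le'; exfalso.
by lra.
Qed.

(** * Covers of families of d-intervals *)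

Section PointCovers.

Variables (R : realFieldType) (m : nat) (H : 'I_m -> seq (R * R)).
Hypothesis H_nonempty : forall i, H i != [::].
Hypothesis H_le : forall i ab, ab \in H i -> ab.1 <= ab.2.

Definition in_edge (x : R) (i : 'I_m) : bool := has (fun ab => ab.1 <= x <= ab.2) (H i).
Definition meets (i j : 'I_m) : bool := `[< exists x, in_edge x i && in_edge x j >].

Lemma meets_refl : reflexive meets.
Proof.
move=> i; apply/asboolP; case E: (H i) (H_nonempty i) => [//|ab s] _.
by exists ab.1; rewrite andbb /in_edge E /= lexx (@H_le i) // E mem_head.
Qed.

Lemma meets_sym : symmetric meets.
Proof. by move=> i j; apply/asboolP/asboolP => -[x]; rewrite andbC; exists x. Qed.

(** Of two components sharing a point, the larger left endpoint lies in both. *)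
Lemma meets_left_endpoint i j : meets i j ->
  has (in_edge^~ j) (unzip1 (H i)) || has (in_edge^~ i) (unzip1 (H j)).
Proof.
move=> /asboolP[x /andP[/hasP[ab abi /andP[ax xb]] /hasP[cd cdj /andP[cx xd]]]].
have [ac|ca] := leP ab.1 cd.1; apply/orP; [right|left]; apply/hasP.
  by exists cd.1; [apply: map_f | apply/hasP; exists ab; rewrite // ac (le_trans cx)].
by exists ab.1; [apply: map_f | apply/hasP; exists cd; rewrite // (ltW ca) (le_trans ax)].
Qed.

Let endpoints := flatten [seq unzip1 (H i) ++ unzip2 (H i) | i <- enum 'I_m].

(** Real endpoints become integer positions in the same order, as [balanced_cut] requires. *)
Definition endpoint_rank (v : R) : nat := count (fun u => u < v) endpoints.

Lemma mem_endpoints i ab : ab \in H i -> ab.1 \in endpoints /\ ab.2 \in endpoints.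
Proof.
move=> abi; split; apply/flattenP; exists (unzip1 (H i) ++ unzip2 (H i));
  by rewrite ?mem_cat ?map_f ?orbT // ; apply/mapP; exists i; rewrite ?mem_enum.
Qed.

Lemma endpoint_rank_le u v : u <= v -> (endpoint_rank u <= endpoint_rank v)%N.
Proof. by move=> uv; apply: sub_count => x /= xu; apply: lt_le_trans uv. Qed.

Lemma endpoint_rank_lt u v : u \in endpoints -> u < v ->
  (endpoint_rank u < endpoint_rank v)%N.
Proof.
rewrite /endpoint_rank; elim: endpoints => // x s IHs; rewrite inE => us uv /=.
have le : (count (fun y => y < u)%R s <= count (fun y => y < v)%R s)%N.
  by apply: sub_count => y /= yu; apply: lt_trans uv.
move: us => /orP[/eqP ux|us]; first by rewrite -ux ltxx uv add0n add1n ltnS.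
rewrite -addnS; apply: leq_add (IHs us uv).
by case: (ltP x u) => // xu; rewrite (lt_trans xu uv).
Qed.

Lemma exists_max (s : seq R) : s != [::] -> exists2 z, z \in s & forall u, u \in s -> u <= z.
Proof.
elim: s => // x [|y s] IHs _; first by exists x; rewrite ?mem_head // => u; rewrite inE => /eqP->.
have [//|z zs zmax] := IHs; have [xz|zx] := leP x z.
  exists z; first by rewrite inE zs orbT.
  by move=> u; rewrite inE => /orP[/eqP->//|/zmax].
exists x; first by rewrite mem_head.
by move=> u; rewrite inE => /orP[/eqP->//|/zmax uz]; apply: le_trans uz (ltW zx).
Qed.

(** The largest endpoint of rank below [p] works: were it beyond [ab.2], the rank of [ab.2] would be
    less than [p - 1]. If there is none, no interval qualifies and 0 is arbitrary. *)
Lemma point_of_rank (p : nat) : exists z : R, forall i ab, ab \in H i ->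
  ((endpoint_rank ab.1).+1 <= p <= (endpoint_rank ab.2).+1)%N -> ab.1 <= z <= ab.2.
Proof.
pose s := [seq u <- endpoints | (endpoint_rank u < p)%N].
have [s0|/exists_max[z zs zmax]] := eqVneq s [::].
  exists 0 => i ab abi /andP[pa _]; have [aE _] := mem_endpoints abi.
  by have : ab.1 \in s; [rewrite mem_filter pa | rewrite s0].
exists z => i ab abi /andP[pa pb]; have [aE bE] := mem_endpoints abi.
rewrite zmax /=; last by rewrite mem_filter pa.
rewrite leNgt; apply/negP => /(endpoint_rank_lt bE).
by move: zs; rewrite mem_filter => /andP[zp _]; lia.
Qed.

(** [Hc] abstracts the matching theorem, with [c = 1] for loops and [c = 3] for graphs. If [c * n]
    points never suffice, the [c * n + 1] balanced segments yield more than [n] edges that do not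
    meet. *)
Lemma cover_of_matching (s c n : nat) :
  (forall i, size (H i) <= s)%N ->
  (forall A : {set 'I_m}, independent meets A -> (#|A| <= n)%N) ->
  (forall (S : 'I_m -> {set 'I_(c * n).+1}) (phi : 'I_m -> nat) (P D : nat),
     (forall i, \sum_(e | i \in S e) phi e <= P <= \sum_(e | i \in S e) phi e + D)%N ->
     (D * #|'I_(c * n).+1| < P)%N -> (forall e, #|S e| <= s)%N ->
     exists2 Mt, matching S phi Mt & (#|'I_(c * n).+1| <= c * #|Mt|)%N) ->
  exists2 pts : seq R, size pts = (c * n)%N & forall i, has (in_edge^~ i) pts.
Proof.
move=> Hs An Hc; apply: contrapT => nocover.
pose E i := [seq ((endpoint_rank ab.1).+1, (endpoint_rank ab.2).+1) | ab <- H i].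
have E_bounded e ab : ab \in E e -> (0 < ab.1 <= ab.2)%N /\ (ab.2 <= (size endpoints).+1)%N.
  case/mapP => cd cde -> /=; rewrite !ltnS; split; last exact: count_size.
  exact: endpoint_rank_le (H_le cde).
have E_nonempty e : E e != [::] by rewrite -size_eq0 size_map size_eq0.
have E_no_cover (p : nat -> nat) : exists e, forall ab, ab \in E e ->
    forall j, (j < c * n)%N -> ~~ (ab.1 <= p j <= ab.2)%N.
  have [z zP] := choice point_of_rank.
  apply: contrapT => /forallNP Hp; apply: nocover.
  exists [seq z (p j) | j <- iota 0 (c * n)]; first by rewrite size_map size_iota.
  move=> i; have /existsNP[ab /not_implyP[abE]] := Hp i.
  move=> /existsNP[j /not_implyP[jn /negP/negPn jab]].
  have /mapP[cd cdi abcd] := abE.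
  apply/hasP; exists (z (p j)); first by rewrite map_f // mem_iota.
  by apply/hasP; exists cd => //; apply: zP cdi _; move: jab; rewrite abcd.
(* The scale exceeds the load error [4 * m] times the number of segments, which is the largeness
   condition of [Hc]. *)
have [S [phi [P [Ssize Sdis load GP]]]] :=
  @balanced_cut m (c * n) _ (4 * m * (c * n).+1).+1 E E_bounded E_nonempty E_no_cover isT.
have [| |Mt mM] := Hc S phi P (4 * m)%N load.
- by rewrite card_ord.
- by move=> e; apply: leq_trans (Ssize e) _; rewrite size_map.
have /matchingP[pos dis] := mM.
rewrite card_ord; suff /An le : independent meets Mt by rewrite ltnNge leq_mul2l le orbT.
move=> i j iM jM /asboolP[x /andP[/hasP[ab abi /andP[ax xb]] /hasP[cd cdj /andP[cx xd]]]].
apply/eqP; apply: contraT => ij.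
have SS : [disjoint S i & S j].
  apply/pred0P => v /=; apply/negbTE/andP => -[vi vj].
  by move/eqP: ij; apply; apply: dis vi vj.
(* The position of the larger left endpoint is common to both integer intervals. *)
pose q := (endpoint_rank (Num.max ab.1 cd.1)).+1.
have := Sdis i j _ _ q (pos i iM) (pos j jM) SS (map_f _ abi) (map_f _ cdj).
rewrite /q /= !ltnS !endpoint_rank_le ?le_max ?ge_max ?lexx ?orbT //=.
- by move=> /(_ isT).
all: by rewrite ?(le_trans ax xb) ?(le_trans cx xb) ?(le_trans ax xd) ?(le_trans cx xd).
Qed.

End PointCovers.

(** * Transfer to hypergraphs given by lists over the standard reals *)

Local Notation real := Rdefinitions.R.

Lemma membE (x : real) (h : dint) : memb x h = has (fun ab => ab.1 <= x <= ab.2) h.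
Proof.
elim: h => //= ab h ->; congr (_ || _); rewrite /in_interval /=.
case: RIneq.Rle_dec => [/RleP->|n1]; last by case: RleP.
by case: RIneq.Rle_dec => [/RleP->|n2] //; case: RleP.
Qed.

Lemma total_weightE g : total_weight g = \sum_(p <- g) p.2.
Proof. by elim: g => [|p g IHg]; rewrite ?big_nil // big_cons -IHg. Qed.

Lemma weight_onE g h : weight_on g h = \sum_(p <- g) (if memb p.1 h then p.2 else 0).
Proof. by elim: g => [|p g IHg]; rewrite ?big_nil // big_cons -IHg. Qed.

Lemma Forall_nthP (T : Type) (x0 : T) (Q : T -> Prop) (s : seq T) :
  List.Forall Q s <-> forall i, (i < size s)%N -> Q (nth x0 s i).
Proof.
split=> [|Hs]; first by elim=> // x s' Qx _ IHs [|i] //=; apply: IHs.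
elim: s Hs => [|x s IHs] Hs; first exact: List.Forall_nil.
by apply: List.Forall_cons; [apply: (Hs 0%N) | apply: IHs => i; apply: (Hs i.+1)].
Qed.

Lemma list_nthE (T : Type) (x0 : T) (s : seq T) i : List.nth i s x0 = nth x0 s i.
Proof. by elim: s i => [|x s IHs] [|i] //=. Qed.

Lemma InE (T : eqType) (x : T) (s : seq T) : List.In x s <-> x \in s.
Proof.
elim: s => // y s IHs; rewrite inE /=; split=> [[->|/IHs->]|/orP[/eqP->|/IHs]].
- by rewrite eqxx.
- by rewrite orbT.
- by left.
- by right.
Qed.

Lemma NoDup_uniq (T : eqType) (s : seq T) : uniq s -> List.NoDup s.
Proof.
elim: s => [|x s IHs] /=; first by move=> _; apply: List.NoDup_nil.
by case/andP=> xs /IHs; apply: List.NoDup_cons => /InE; apply/negP.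
Qed.

Section Hypergraph.

Variables (d : nat) (H : hypergraph) (n : nat) (t : real).
Hypothesis H_d : is_d_hypergraph d H.
Hypothesis H_nu : is_nu H n.
Hypothesis H_tau : is_tau_star H t.

Let edge (i : 'I_(size H)) : seq (real * real) := nth [::] H i.

Lemma edge_d i : is_d_interval d (edge i).
Proof. exact: ((Forall_nthP [::] _ _).1 H_d _ (ltn_ord i)). Qed.

Lemma edge_nonempty i : edge i != [::].
Proof. by have [[/ssrnat.leP + _] _] := edge_d i; case: (edge i). Qed.

Lemma edge_size i : (size (edge i) <= d)%N.
Proof. by have [[_ /ssrnat.leP]] := edge_d i. Qed.

Lemma edge_le i ab : ab \in edge i -> ab.1 <= ab.2.
Proof. by have [_ [/List.Forall_forall le _]] := edge_d i => /InE/le/RleP. Qed.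

Lemma edge_matching (A : {set 'I_(size H)}) : independent (meets edge) A -> (#|A| <= n)%N.
Proof.
move=> indA; have [_ /(_ [seq val i | i <- enum A])] := H_nu.
have -> : length [seq val i | i <- enum A] = #|A| by rewrite cardE -(size_map val).
move=> Hm; apply/ssrnat.leP; apply: Hm; split; [|split].
- by apply: NoDup_uniq; rewrite map_inj_uniq ?enum_uniq //; apply: val_inj.
- by move=> i /InE/mapP[j _ ->]; apply/ssrnat.ltP/ltn_ord.
- move=> _ _ /InE/mapP[i iA ->] /InE/mapP[j jA ->] ij [x]; rewrite !list_nthE !membE => -[xi xj].
  apply: ij; congr val; move: iA jA; rewrite !mem_enum => iA jA; apply: indA => //.
  by apply/asboolP; exists x; rewrite /in_edge xi xj.
Qed.

Lemma tau_star_le_cover (g : seq (real * real)) :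
  all (fun p => 0 <= p.2) g ->
  (forall i, 1 <= \sum_(p <- g) (if in_edge edge p.1 i then p.2 else 0)) ->
  t <= \sum_(p <- g) p.2.
Proof.
move=> g0 gH; apply/RleP; rewrite -total_weightE; apply: (H_tau.1).
exists g; split=> //; split.
  by apply/(Forall_nthP (0, 0)) => i ig; apply/RleP; apply: (allP g0); apply: mem_nth.
apply/(Forall_nthP [::]) => i iH; rewrite weight_onE; apply/RleP.
apply: le_trans (gH (Ordinal iH)) _.
by rewrite le_eqVlt; apply/orP; left; apply/eqP; apply: eq_bigr => p _; rewrite membE.
Qed.

Lemma tau_star_le_points (pts : seq real) :
  (forall i, has ((in_edge edge)^~ i) pts) -> t <= (size pts)%:R.
Proof.
move=> Hp; have -> : (size pts)%:R = \sum_(p <- [seq (x, 1 : real) | x <- pts]) p.2.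
  by rewrite big_map /= big_const_seq iter_addr_0 count_predT.
apply: tau_star_le_cover => [|i]; first by apply/allP => _ /mapP[x _ ->] /=; rewrite ler01.
have /hasP[x xp xi] := Hp i.
rewrite big_map (perm_big _ (perm_to_rem xp)) big_cons /= xi lerDl sumr_ge0 // => y _.
by case: ifP; rewrite ?ler01.
Qed.

Lemma tau_star_le_turan : t <= (2 * d * n)%:R.
Proof.
have size1 i : (size (unzip1 (edge i)) <= d)%N by rewrite size_map edge_size.
have [g [g0 gH gT]] := @cover_of_turan real _ d n _ (fun i => unzip1 (edge i)) (in_edge edge)
  (meets edge) size1 (meets_refl edge_nonempty edge_le)
  (@meets_sym _ _ edge) (@meets_left_endpoint _ _ edge) edge_matching.
exact: le_trans (tau_star_le_cover g0 gH) gT.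
Qed.

Lemma tau_star_le_nu : (d <= 1)%N -> t <= n%:R.
Proof.
move=> d1; have [||pts szp Hp] :=
  @cover_of_matching _ _ edge edge_nonempty edge_le 1 1 n _ edge_matching.
- by move=> i; apply: leq_trans (edge_size i) d1.
- move=> S phi P D load large S1; have [Mt mM le] := loops_matching load large S1.
  by exists Mt => //; rewrite [leqRHS]mul1n.
by rewrite -[n]mul1n -szp; apply: tau_star_le_points.
Qed.

Lemma tau_star_le_3nu : (d <= 2)%N -> t <= (3 * n)%:R.
Proof.
move=> d2; have [||pts szp Hp] :=
  @cover_of_matching _ _ edge edge_nonempty edge_le 2 3 n _ edge_matching.
- by move=> i; apply: leq_trans (edge_size i) d2.
- by move=> S phi P D load large S2; exact: edges_matching load large S2.
by rewrite -szp; apply: tau_star_le_points.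
Qed.

End Hypergraph.

Lemma tau_star_bounds (d : nat) (H : hypergraph) (n : nat) (t : real) :
  is_d_hypergraph d H -> is_nu H n -> is_tau_star H t ->
  [/\ Rle t (INR (2 * d * n)), (d <= 1)%N -> Rle t (INR n) &
      (d <= 2)%N -> Rle t (INR (3 * n))].
Proof.
move=> Hd Hn Ht; split=> [|d1|d2]; apply/RleP; rewrite INRE.
- exact: tau_star_le_turan Hd Hn Ht.
- exact: tau_star_le_nu Hd Hn Ht d1.
- exact: tau_star_le_3nu Hd Hn Ht d2.
Qed.

End DIntervals.

Theorem theorem7p1 (d : nat) (H : hypergraph) (n : nat) (t : R) :
  (1 <= d)%nat ->
  is_d_hypergraph d H ->
  is_nu H n ->
  is_tau_star H t ->
  t <= (4 * INR d - 6 + 3 / INR d) * INR n.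
Proof.
intros d1 Hd Hn Ht.
destruct (DIntervals.tau_star_bounds Hd Hn Ht) as [turan nu1 nu3].
assert (n0 := pos_INR n).
(* The factor is 1 at [d = 1] and 7/2 at [d = 2], below [2 * d] both times; these cases use the
   bounds with 1 and 3. *)
destruct d as [|[|[|d]]].
- inversion d1.
- specialize (nu1 eq_refl); simpl; lra.
- specialize (nu3 eq_refl); rewrite mult_INR in nu3; simpl in *; lra.
- rewrite !mult_INR in turan.
  assert (d3 : 3 <= INR (S (S (S d)))) by (rewrite !S_INR; assert (h := pos_INR d); lra).
  revert d3 turan; generalize (INR (S (S (S d)))); intros x x3 turan.
  apply Rle_trans with (1 := turan), Rmult_le_compat_r; [exact n0|].
  (* The excess over [2 * x] is written as a fraction whose numerator is visibly positive for
     [x >= 3]. *)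
  replace (4 * x - 6 + 3 / x) with (2 * x + (2 * x * (x - 3) + 3) / x) by (field; lra).
  replace (INR 2) with 2 by (simpl; lra).
  assert (0 <= (2 * x * (x - 3) + 3) / x); [|lra].
  apply Rle_mult_inv_pos; nra.
Qed.
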